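(* There exists a constant $c$ such that for every positive integer $k$, every Hamiltonian graph $G$ on $n \ge c k^{7/3}$ vertices with $\alpha(G) \le k$ is pancyclic.
   Context: Graphs are finite and simple. $\alpha(G)$ denotes the independence number of $G$, i.e. the order of a maximum independent set. A Hamilton cycle is a cycle passing through every vertex of the graph exactly once, and a graph is Hamiltonian if it contains a Hamilton cycle. A graph on $n$ vertices is pancyclic if it contains a cycle of length $\ell$ for every integer $\ell$ with $3 \le \ell \le n$. *)

(* Defs.v *)
From mathcomp Require Import all_boot.

Set Implicit Arguments.
Unset Strict Implicit.
Unset Printing Implicit Defensive.

Record sgraph := SGraph {
  vertex :> finType;
  adj : rel vertex;
  adj_sym : symmetric adj;
  adj_irrefl : irreflexive adj }.

Section GraphNotions.
Variable G : sgraph.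

Definition independent (A : {set G}) : bool :=
  [forall x in A, forall y in A, ~~ adj x y].

Definition independence_number : nat :=
  \max_(A : {set G} | independent A) #|A|.

(* [ucycleb] also accepts the empty sequence and the sequence [:: x; y] of two
   adjacent vertices; the size condition rules these out, so in particular
   graphs with fewer than three vertices are not Hamiltonian. *)
Definition graph_cycle (s : seq G) : bool :=
  (3 <= size s) && ucycleb (@adj G) s.

Definition hamilton_cycle (s : seq G) : Prop :=
  graph_cycle s /\ forall x : G, x \in s.

Definition hamiltonian : Prop := exists s : seq G, hamilton_cycle s.

Definition pancyclic : Prop :=
  forall l : nat, 3 <= l <= #|G| ->
    exists s : seq G, graph_cycle s /\ size s = l.

End GraphNotions.

(* Main.v *)
Require Import Defs.
From mathcomp Require Import all_boot all_order all_algebra.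
From mathcomp Require Import reals exp.
From mathcomp Require Import boolp.
From mathcomp Require Import zify.

(** Let [k] bound the independence number, so that any [k + 1] vertices span an
    edge; put [l = k^(1/3)], rounded up, so that [n >= C k^2 l].

    Lengths close to [n]: a path [T] with at least [66 k^2 l] vertices can be
    replaced by one with the same ends and one vertex less. Stacking [k + 2]
    maximal independent sets gives [X] inside [T], [#|X| <= k (k + 2)], such that
    every other vertex of [T] has [k + 2] neighbours in [X] and can therefore be
    inserted into any path containing [X]. So it suffices to find some shorter
    path through [X] with the same ends. Among the [8 k^2] intervals of [T] of
    length about [4 l] that avoid [X], a chord inside an interval, two parallel
    edges between two intervals, or a suitable 4-cycle of edges through four
    intervals allows such a rerouting, and counting edges with Turan's theorem
    shows that one of these occurs.

    Lengths between [6 k] and [n - 24 k^2]: among the first [24 k^2] vertices of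
    the Hamilton cycle there is a set [F] that stays connected after removing any
    [8 k] vertices. A chain of [2 k] triangles in [F] gives a path whose length
    can be varied by [2 k]; it is closed up through [F] and the part of the
    Hamilton cycle outside [F], which can be shortened along chords in steps
    smaller than [2 k].

    Lengths below [6 k]: the argument of Erdos, Faudree, Rousseau and Schelp
    bounding the Ramsey number of a cycle against a complete graph. In a graph
    without a cycle of length [m], the breadth-first layers at depth less than
    [m / 2] are [(m - 2)]-colourable, hence they are small; cutting at a layer
    where they stop growing yields a large independent set. *)

Set Implicit Arguments.
Unset Strict Implicit.
Unset Printing Implicit Defensive.

(** * Independent sets and Turan's bound *)


Lemma double_count (I J : finType) (A : {pred I}) (B : {pred J})
    (r : I -> J -> bool) :
  \sum_(x in A) #|[set y in B | r x y]| = \sum_(y in B) #|[set x in A | r x y]|.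
Proof.
under eq_bigr => x _ do rewrite -sum1dep_card big_mkcondr.
rewrite exchange_big /=; apply: eq_bigr => y _.
by rewrite -sum1dep_card [RHS]big_mkcondr.
Qed.

Section Independence.
Variable G : sgraph.
Implicit Types (A S X : {set G}).

Definition alpha S : nat := \max_(A : {set G} | independent A && (A \subset S)) #|A|.

Definition alpha_le k := forall A, independent A -> #|A| <= k.

Definition nbrs S (x : G) : {set G} := [set y in S | adj x y].

(** Every edge inside [S] counts twice, once from each end. *)
Definition edges S : nat := \sum_(x in S) #|nbrs S x|.

Lemma independentP A :
  reflect {in A &, forall x y, ~~ adj x y} (independent A).
Proof.
apply: (iffP forall_inP) => [H x y xA yA|H x xA].
  by have /forall_inP := H x xA; apply.
by apply/forall_inP => y yA; apply: H.
Qed.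

Lemma alpha_le_indnum k : independence_number G <= k -> alpha_le k.
Proof. by move=> h A iA; apply: leq_trans h; apply: leq_bigmax_cond. Qed.

Lemma leq_alpha S A : independent A -> A \subset S -> #|A| <= alpha S.
Proof.
by move=> iA AS; apply: (@leq_bigmax_cond _ _ (fun A => #|A|)); rewrite iA.
Qed.

Lemma alphaP S : exists A, [/\ independent A, A \subset S & #|A| = alpha S].
Proof.
have h : (fun A => independent A && (A \subset S)) set0.
  by rewrite sub0set andbT; apply/independentP => x y; rewrite inE.
case: (@eq_bigmax_cond _ (fun A => independent A && (A \subset S)) (fun A => #|A|)).
  by apply/card_gt0P; exists set0.
by move=> A /andP[iA AS] eqA; exists A.
Qed.

Lemma alpha_leq k S : alpha_le k -> alpha S <= k.
Proof. by move=> ak; have [A [iA _ <-]] := alphaP S; apply: ak. Qed.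

Lemma alpha_gt0 S : S != set0 -> 0 < alpha S.
Proof.
case/set0Pn => x xS; rewrite -(cards1 x); apply: leq_alpha.
  by apply/independentP => y z /set1P-> /set1P->; rewrite adj_irrefl.
by rewrite sub1set.
Qed.

(** The union of maximum independent sets of the two parts is again independent. Both cutting
    arguments below rest on this superadditivity. *)
Lemma alphaU S S1 S2 : S1 \subset S -> S2 \subset S ->
  {in S1 & S2, forall x y, x != y /\ ~~ adj x y} ->
  alpha S1 + alpha S2 <= alpha S.
Proof.
move=> S1S S2S h.
have [A1 [i1 s1 <-]] := alphaP S1; have [A2 [i2 s2 <-]] := alphaP S2.
have hA x y : x \in A1 -> y \in A2 -> x != y /\ ~~ adj x y.
  by move=> /(subsetP s1) ? /(subsetP s2) ?; apply: h.
rewrite -cardsUI (_ : A1 :&: A2 = set0) ?cards0 ?addn0; last first.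
  apply/setP => x; rewrite !inE; apply/negP => /andP[x1 x2].
  by case: (hA _ _ x1 x2); rewrite eqxx.
apply: leq_alpha; last by rewrite subUset (subset_trans s1) ?(subset_trans s2).
apply/independentP => x y /setUP[] hx /setUP[] hy.
- exact: (independentP _ i1).
- by case: (hA _ _ hx hy).
- by rewrite adj_sym; case: (hA _ _ hy hx).
- exact: (independentP _ i2).
Qed.

Lemma exists_edge k S : alpha_le k -> k < #|S| ->
  exists x y, [/\ x \in S, y \in S & adj x y].
Proof.
move=> ak; rewrite ltnNge => /negP hS.
have /forall_inPn [x xS /forall_inPn[y yS]] : ~~ independent S.
  by apply/negP => /ak.
by rewrite negbK => xy; exists x, y.
Qed.

(** A maximum independent subset works: a vertex of [S] without a neighbour in it could be added. *)
Lemma dominating_independent S : exists A,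
  [/\ independent A, A \subset S &
      {in S :\: A, forall x, exists2 y, y \in A & adj x y}].
Proof.
have [A [iA AS eA]] := alphaP S; exists A; split=> // x /setDP[xS xA].
apply/exists_inP; apply: contraT => /exists_inPn nx.
suff : #|x |: A| <= #|A| by rewrite cardsU1 xA; lia.
rewrite eA; apply: leq_alpha; last by rewrite subUset sub1set xS.
apply/independentP => y z /setU1P[->|yA] /setU1P[->|zA].
- by rewrite adj_irrefl.
- exact: nx.
- by rewrite adj_sym nx.
- exact: (independentP _ iA).
Qed.

(** Peel off [t] dominating independent sets in turn. They are disjoint, and a vertex that is never
    peeled has a neighbour in each of them. *)
Lemma dominating_layers k t S : alpha_le k -> exists X,
  [/\ X \subset S, #|X| <= t * k &
      {in S :\: X, forall w, t <= #|nbrs X w|}].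
Proof.
move=> ak; elim: t => [|t [X [XS cX hX]]].
  by exists set0; split; rewrite ?sub0set ?cards0.
have [A [iA AS hA]] := dominating_independent (S :\: X).
have dis : [disjoint X & A].
  rewrite disjoint_sym disjoint_subset; apply/subsetP => x /(subsetP AS).
  by rewrite !inE => /andP[].
exists (X :|: A); split.
- by rewrite subUset XS (subset_trans AS) // subsetDl.
- rewrite mulSn addnC (leq_trans (leq_card_setU _ _)) // leq_add //.
  exact: ak.
- move=> w /setDP[wS]; rewrite inE negb_or => /andP[wX wA].
  have [|y yA wy] := hA w; first by rewrite !inE wA wX.
  have := hX w; rewrite inE wX wS => /(_ isT) h.
  apply: (@leq_trans #|y |: nbrs X w|).
    rewrite cardsU1 inE (_ : y \in X = false) ?andFb ?add1n //.
    by apply: (disjointFl dis yA).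
  apply: subset_leq_card; apply/subsetP => z; rewrite !inE.
  by case/predU1P => [->|/andP[-> ->]]; rewrite ?yA ?wy ?orbT.
Qed.

(* Peel off a maximal independent set: it receives at least one edge from every
   other vertex. *)
Lemma turan k S : alpha_le k -> #|S| ^ 2 <= k * (edges S + #|S|).
Proof.
move=> ak; have [m] := ubnP #|S|; elim: m S => // m IH S /ltnSE hm.
have [->|S0] := eqVneq S set0; first by rewrite cards0.
have [A [iA AS hA]] := dominating_independent S.
have A0 : 0 < #|A|.
  rewrite card_gt0; apply: contra_neq S0 => A0; apply/setP => x; rewrite inE.
  by apply/negP => xS; case: (hA x); rewrite A0 ?inE // => y; rewrite inE.
have cS : #|S| = #|A| + #|S :\: A|.
  by rewrite cardsD (setIidPr AS) subnKC ?subset_leq_card.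
have {}IH : #|S :\: A| ^ 2 <= k * (edges (S :\: A) + #|S :\: A|).
  by apply: IH; lia.
(* Each vertex outside [A] sends an edge to [A], and that edge counts from both ends; hence the
   factor 2. *)
have cE : edges (S :\: A) + 2 * #|S :\: A| <= edges S.
  rewrite [edges S](big_setID A) /= (setIidPr AS).
  have h1 : #|S :\: A| <= \sum_(x in A) #|nbrs S x|.
    rewrite /nbrs double_count.
    apply: (@leq_trans (\sum_(y in S :\: A) #|[set x in A | adj x y]|)).
      rewrite -sum1_card; apply: leq_sum => y /hA[x xA yx].
      by apply/card_gt0P; exists x; rewrite !inE xA adj_sym.
    rewrite [X in _ <= X](big_setID A) /= addnC leq_addr //.
  have h2 : edges (S :\: A) + #|S :\: A| <=
      \sum_(x in S :\: A) #|nbrs S x|.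
    rewrite /edges -sum1_card -big_split /=; apply: leq_sum => x xSA.
    have [y yA xy] := hA x xSA.
    apply: (@leq_trans #|y |: nbrs (S :\: A) x|).
      by rewrite cardsU1 !inE yA /= add1n addn1.
    apply: subset_leq_card; apply/subsetP => z; rewrite !inE.
    case/predU1P => [->|/andP[/andP[_ ->] ->]] //.
    by rewrite xy (subsetP AS).
  lia.
have kA : #|A| <= k by apply: ak.
nia.
Qed.

End Independence.

(** * Edges between intervals *)


Lemma card_pairs_sum (I J : finType) (r : I -> J -> bool) :
  #|[set x : I * J | r x.1 x.2]| = \sum_i #|[set j | r i j]|.
Proof.
under [RHS]eq_bigr => i _ do rewrite -sum1dep_card big_mkcond.
by rewrite pair_big /= -sum1dep_card [LHS]big_mkcond.
Qed.

Lemma double_countT (I J : finType) (r : I -> J -> bool) :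
  \sum_x #|[set y | r x y]| = \sum_y #|[set x | r x y]|.
Proof.
under eq_bigr => x _ do rewrite -sum1dep_card big_mkcond.
rewrite exchange_big /=; apply: eq_bigr => y _.
by rewrite -sum1dep_card [RHS]big_mkcond.
Qed.

(* Charge (x, y) to x when y is the least element related to x, and to y otherwise. *)
Lemma card_antitone_rel m n (r : 'I_m -> 'I_n -> bool) :
  (forall (x x' : 'I_m) (y y' : 'I_n), x < x' -> y < y' -> r x y -> ~~ r x' y') ->
  \sum_x #|[set y | r x y]| <=
    #|[set x | [exists y, r x y]]| + #|[set y | [exists x, r x y]]|.
Proof.
move=> anti; rewrite -card_pairs_sum.
pose R := [set x : 'I_m * 'I_n | r x.1 x.2].
pose M := [set x : 'I_m * 'I_n | [forall y : 'I_n, (y < x.2) ==> ~~ r x.1 y]].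
rewrite -/R -(cardsID M R); apply: leq_add.
  have injf : {in R :&: M &, injective fst}.
    move=> [x y] [x' y']; rewrite !inE /= => /andP[r1 /forallP m1] /andP[r2 /forallP m2] E.
    rewrite -E in r2 m2 *; suff -> : y = y' by [].
    apply: ord_inj; have := m1 y'; have := m2 y; rewrite r1 r2 /=.
    by case: ltngtP.
  rewrite -(card_in_imset injf); apply: subset_leq_card; apply/subsetP => x.
  by case/imsetP => -[x' y]; rewrite !inE /= => /andP[h _] ->; apply/existsP; exists y.
have injf : {in R :\: M &, injective snd}.
  have aux x (y : 'I_n) x' : forall y0 : 'I_n, y0 < y -> r x' y0 -> r x y -> x' < x -> False.
    by move=> y0 lt0 r0 h lt; have := anti _ _ _ _ lt lt0 r0; rewrite h.
  move=> [x y] [x' y']; rewrite !inE /= => /andP[/forallPn[y1] n1 r1] /andP[/forallPn[y2] n2 r2] E.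
  rewrite -E in r2 n2 *; suff -> : x = x' by [].
  move: n1; rewrite negb_imply negbK => /andP[? ?].
  move: n2; rewrite negb_imply negbK => /andP[? ?].
  apply: ord_inj; case: (ltngtP x x') => // lt.
    by exfalso; apply: (aux x' y x y1).
  by exfalso; apply: (aux x y x' y2).
rewrite -(card_in_imset injf); apply: subset_leq_card; apply/subsetP => y.
by case/imsetP => -[x y']; rewrite !inE /= => /andP[_ h] ->; apply/existsP; exists x.
Qed.

(** Cauchy-Schwarz against the constant 1, by summing [2xy <= x^2 + y^2] over all pairs of
    indices. *)
Lemma sum_sqr_leq (I : finType) (D : I -> nat) :
  (\sum_i D i) ^ 2 <= #|I| * \sum_i D i ^ 2.
Proof.
rewrite -(@leq_pmul2l 2) // -mulnn.
have -> : 2 * (#|I| * \sum_i D i ^ 2) = \sum_i \sum_j (D i ^ 2 + D j ^ 2).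
  under [RHS]eq_bigr => i _ do rewrite big_split /= sum_nat_const.
  by rewrite big_split /= sum_nat_const -big_distrr /= mul2n addnn.
rewrite big_distrl big_distrr /=; apply: leq_sum => i _.
rewrite big_distrr big_distrr /=; apply: leq_sum => j _.
by have [h _] := nat_Cauchy (D i) (D j).
Qed.

Section PullBack.
Variables (G : sgraph) (P : finType) (f : P -> G).

(** Copies the adjacency of [G] to an index type, so that Turan's bound applies to families of
    positions. *)
Definition pullback : sgraph :=
  @SGraph P (relpre f (@adj G)) (fun x y => adj_sym (f x) (f y))
    (fun x => adj_irrefl (f x)).

Lemma alpha_le_pullback k : injective f -> alpha_le G k -> alpha_le pullback k.
Proof.
move=> injf ak A /independentP iA; rewrite -(card_imset _ injf); apply: ak.
apply/independentP => _ _ /imsetP[x xA ->] /imsetP[y yA ->].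
exact: (iA x y).
Qed.
End PullBack.

Section Counting.
Variables (G : sgraph) (k l : nat) (I : finType) (f : I -> nat -> G).
Hypotheses (ak : alpha_le G k) (l_gt0 : 0 < l) (l_le : l <= k) (k_le : k <= l ^ 3)
  (cardI : 8 * k ^ 2 <= #|I|).
Hypothesis f_inj : forall i j p q, p <= l.*2 -> q <= l.*2 ->
  f i p = f j q -> i = j /\ p = q.
Hypothesis no_chord : forall i p q, p <= l.*2 -> q <= l.*2 -> ~~ adj (f i p) (f i q).
Hypothesis no_parallel : forall i j p p' q q', i != j -> p < p' <= l.*2 -> q < q' <= l.*2 ->
  adj (f i p) (f j q) -> ~~ adj (f i p') (f j q').

(** Interval [i] has positions [0] to [2l]. The map [a] covers the first [l] of them and [b] the
    last [l]; position [l] lies in neither half. *)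
Let P : finType := (I * 'I_l)%type.
Let a (x : P) := f x.1 x.2.
Let b (x : P) := f x.1 (l.+1 + x.2).
Let A := pullback a.
Let B := pullback b.

Let sees (v : P) j := [exists q : 'I_l, adj (a v) (f j q)].
Let D v := #|[set j | sees v j]|.

Lemma inj_low : injective a.
Proof.
move=> [i p] [j q] /f_inj/= h; have lp := ltn_ord p; have lq := ltn_ord q.
by have [||-> /val_inj ->] := h; try lia.
Qed.

Lemma inj_high : injective b.
Proof.
move=> [i p] [j q] /f_inj/= h; have lp := ltn_ord p; have lq := ltn_ord q.
by have [||-> /addnI /val_inj ->] := h; try lia.
Qed.

(** Without parallel edges the adjacency between two lower halves is antitone, so its edges number
    at most the vertices, on both sides together, that see the other half. A half has no edges
    inside. *)
Lemma edges_low_leq : edges [set: A] <= 2 * \sum_v D v.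
Proof.
have sumD : \sum_v D v = \sum_i \sum_j #|[set p : 'I_l | sees (i, p) j]|.
  rewrite /D -(pair_bigA _ (fun i p => #|[set j | sees (i, p) j]|)) /=.
  by apply: eq_bigr => i _; rewrite double_countT.
have -> : edges [set: A] =
    \sum_i \sum_j \sum_(p : 'I_l) #|[set q : 'I_l | adj (a (i, p)) (a (j, q))]|.
  rewrite /edges.
  transitivity (\sum_(x : P) \sum_j #|[set q : 'I_l | adj (a x) (a (j, q))]|).
    apply: eq_big => [x|x _]; first by rewrite inE.
    rewrite -card_pairs_sum; apply: eq_card => -[j q]; by rewrite !inE.
  rewrite -(pair_bigA _ (fun i p => \sum_j #|[set q : 'I_l | adj (a (i, p)) (a (j, q))]|)) /=.
  by apply: eq_bigr => i _; rewrite exchange_big.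
rewrite mul2n -addnn {1}sumD sumD [X in _ <= _ + X]exchange_big /= -big_split /=.
apply: leq_sum => i _.
rewrite -big_split /=; apply: leq_sum => j _.
have [->|ij] := eqVneq i j.
  rewrite big1 // => p _; apply/eqP; rewrite cards_eq0; apply/eqP/setP => q.
  have lp := ltn_ord p; have lq := ltn_ord q.
  by rewrite !inE; apply/negbTE/no_chord => /=; lia.
apply: leq_trans (card_antitone_rel _) _.
  move=> p p' q q' pp' qq'; have lp := ltn_ord p'; have lq := ltn_ord q'.
  by apply: no_parallel => //=; lia.
apply: leq_add; apply: subset_leq_card; apply/subsetP => q.
  by rewrite !inE => /existsP[p h]; apply/existsP; exists p.
by rewrite !inE => /existsP[p h]; apply/existsP; exists p; rewrite adj_sym.
Qed.

Let W v : {set B} := [set y : P | sees v y.1].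

Lemma card_W v : #|W v| = l * D v.
Proof.
have -> : W v = setX [set j | sees v j] [set: 'I_l].
  by apply/setP => -[j q]; rewrite !inE andbT.
by rewrite cardsX cardsT card_ord mulnC.
Qed.

(** Exchange the sums: an edge of [B] is counted once for every [v] that sees both of its
    intervals. *)
Lemma sum_edges_W :
  (forall u w : B, adj u w -> #|[set v | sees v u.1 && sees v w.1]| <= k) ->
  \sum_v edges (W v) <= k * edges [set: B].
Proof.
move=> few.
have -> : \sum_v edges (W v) =
    \sum_(u : B) \sum_(w : B) @adj B u w * #|[set v | sees v u.1 && sees v w.1]|.
  transitivity (\sum_v \sum_(u : B) \sum_(w : B)
      @adj B u w * (sees v u.1 && sees v w.1)).
    apply: eq_bigr => v _; rewrite /edges big_mkcond /=; apply: eq_bigr => u _.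
    rewrite inE; case: (sees v u.1) => /=.
      rewrite -sum1dep_card big_mkcond /=; apply: eq_bigr => w _.
      by rewrite inE; case: (sees v w.1); case: (adj _ _).
    by rewrite big1 // => w _; rewrite muln0.
  rewrite exchange_big /=; apply: eq_bigr => u _.
  rewrite exchange_big /=; apply: eq_bigr => w _.
  rewrite -big_distrr /= -sum1dep_card; congr (_ * _).
  by rewrite [RHS]big_mkcond; apply: eq_bigr => v _; case: (_ && _).
rewrite /edges big_distrr /=.
rewrite [X in _ <= X](eq_bigl xpredT) => [|u]; last by rewrite inE.
apply: leq_sum => u _; rewrite -sum1dep_card big_distrr [X in _ <= X]big_mkcond /=.
apply: leq_sum => w _; rewrite inE /=.
case: ifP => [uw|_] //; rewrite mul1n muln1; exact: few.
Qed.

(** Otherwise, with [N] intervals and [d] the sum of all [D v], Turan on the sets [W v] and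
    Cauchy-Schwarz give [l * d <= 3 * N * k ^ 2]. Turan on [A] then gives [N * l ^ 3 <= 7 * k ^ 3],
    against [8 * k ^ 2 <= N] and [k <= l ^ 3]. *)
Lemma popular_high_edge : edges [set: B] <= edges [set: A] ->
  exists u w : B, @adj B u w /\ k < #|[set v | sees v u.1 && sees v w.1]|.
Proof.
move=> EBA; suff /existsP[u /existsP[w /andP[uw h]]] : [exists u : P, exists w : P,
    @adj B u w && (k < #|[set v | sees v u.1 && sees v w.1]|)].
  by exists u, w.
apply: contraT => /existsPn nex.
have sW : \sum_v edges (W v) <= k * edges [set: B].
  apply: sum_edges_W => u w uw; rewrite leqNgt; apply/negP => h.
  by have /existsPn/(_ w) := nex u; rewrite uw h.
have sT : \sum_v (l * D v) ^ 2 <= k * (\sum_v edges (W v) + l * \sum_v D v).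
  rewrite big_distrr /= -big_split big_distrr /=; apply: leq_sum => v _.
  rewrite -card_W; apply: turan; exact: alpha_le_pullback inj_high ak.
have tA := turan [set: A] (alpha_le_pullback inj_low ak).
have cP : #|[set: A]| = #|I| * l by rewrite cardsT card_prod card_ord.
have cS := sum_sqr_leq D; rewrite card_prod card_ord in cS.
have sS : \sum_v (l * D v) ^ 2 = l ^ 2 * \sum_v D v ^ 2.
  by rewrite big_distrr; apply: eq_bigr => v _; rewrite expnMn.
rewrite sS {sS} in sT; have low := edges_low_leq.
move: cS sT tA cP low sW EBA cardI.
move: (\sum_v D v) (\sum_v D v ^ 2) (\sum_v edges (W v)) => d d2 w.
move: (edges [set: A]) (edges [set: B]) #|[set: A]| #|I| => eA eB c N.
move=> cS sT tA cP low sW EBA cI.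
have k0 : 0 < k by lia.
have Nl : 8 * k ^ 2 <= N * l by nia.
(* The comparison of the two halves enters here: [w <= k * eB <= k * eA <= 2 * k * d]. *)
have w_le : w <= 2 * k * d by nia.
have d0 : 0 < d.
  rewrite lt0n; apply/eqP => d0; rewrite d0 in low.
  have : c * c <= k * c by nia.
  rewrite leq_pmul2r; nia.
have ld : l * d <= 3 * N * k ^ 2.
  have h1 : l ^ 2 * d ^ 2 <= N * l * (k * (w + l * d)).
    apply: (@leq_trans (l ^ 2 * (N * l * d2))); first by rewrite leq_pmul2l ?expn_gt0 ?l_gt0.
    by rewrite mulnCA leq_pmul2l //; nia.
  have h2 : N * l * (k * (w + l * d)) <= (l * d) * (3 * N * k ^ 2).
    have : w + l * d <= 3 * k * d by nia.
    move/(leq_mul (leqnn (N * l * k))); nia.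
  have h3 : (l * d) * (l * d) <= (l * d) * (3 * N * k ^ 2) by nia.
  by rewrite leq_pmul2l // in h3; rewrite muln_gt0 l_gt0.
have h1 : N ^ 2 * l ^ 3 <= l * (k * (2 * d + N * l)).
  by rewrite cP in tA; have := leq_mul (leqnn l) tA; nia.
have h2 : l * (k * (2 * d + N * l)) <= N * (7 * k ^ 3).
  have : 2 * (l * d) + N * (l * l) <= 7 * N * k ^ 2 by nia.
  move/(leq_mul (leqnn k)); nia.
have N0 : 0 < N by nia.
have h3 : N * l ^ 3 <= 7 * k ^ 3.
  by rewrite -(leq_pmul2l N0); apply: leq_trans h2; nia.
have h4 : N * k <= 7 * k ^ 3 by apply: leq_trans h3; rewrite leq_mul2l k_le orbT.
have h5 : 8 * k ^ 2 * k <= 7 * k ^ 3 by apply: leq_trans h4; rewrite leq_mul2r cI orbT.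
have : 0 < k ^ 3 by rewrite expn_gt0 k0.
move: h5; rewrite -mulnA -expnSr; lia.
Qed.

(* More than [k] vertices see both blocks of a popular edge, so two of them have
   adjacent successors. *)
Lemma four_block_pattern : edges [set: B] <= edges [set: A] ->
  exists (i1 i2 j m : I) (p1 p2 q1 q2 r1 r2 p1' p2' q r : nat),
  [/\ uniq [:: i1; i2; j; m],
   [/\ p1 < p1' <= l.*2, p2 < p2' <= l.*2, maxn q1 q2 < q <= l.*2 & maxn r1 r2 < r <= l.*2],
   [/\ adj (f i1 p1) (f j q1), adj (f i1 p1) (f m r1),
       adj (f i2 p2) (f j q2) & adj (f i2 p2) (f m r2)] &
   adj (f i1 p1') (f i2 p2') /\ adj (f j q) (f m r)].
Proof.
case/popular_high_edge => u [w [uw]].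
set V := [set v | _] => cV.
pose s (v : P) := f v.1 v.2.+1.
have injs : injective s.
  move=> [i p] [j q] /f_inj/= h; have lp := ltn_ord p; have lq := ltn_ord q.
  by have [||-> [] /val_inj ->] := h; try lia.
have [|_ [_ [/imsetP[v1 v1V ->] /imsetP[v2 v2V ->] s12]]] :=
    @exists_edge G k (s @: V) ak.
  by rewrite card_imset.
have nc i p q : p < l -> q < l.*2.+1 -> ~~ adj (f i p) (f i q).
  by move=> *; apply: no_chord; lia.
move: v1V v2V; rewrite !inE => /andP[/existsP[q1 a1] /existsP[r1 a2]].
case/andP=> /existsP[q2 a3] /existsP[r2 a4].
case: v1 v2 u w uw {V cV} s12 a1 a2 a3 a4 => [i1 p1] [i2 p2] [j q] [m r]; rewrite /s /a /=.
move=> uw s12 a1 a2 a3 a4.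
have l1 := ltn_ord p1; have l2 := ltn_ord p2; have lq1 := ltn_ord q1; have lq2 := ltn_ord q2.
have lr1 := ltn_ord r1; have lr2 := ltn_ord r2; have lq := ltn_ord q; have lr := ltn_ord r.
(* The popular edge lies in upper halves, hence the shift by [l.+1]; it puts [q] beyond [q1], [q2]
   and [r] beyond [r1], [r2]. *)
exists i1, i2, j, m, p1, p2, q1, q2, r1, r2, p1.+1, p2.+1, (l.+1 + q), (l.+1 + r).
split=> //; last by split; lia.
rewrite /= !inE !negb_or !andbT; apply/and3P; split; last first.
- apply: contraTneq uw => ->; apply: no_chord => /=; lia.
- apply/andP; split.
    by apply: contraTneq a3 => ->; apply: nc => /=; lia.
  by apply: contraTneq a4 => ->; apply: nc => /=; lia.
- apply/and3P; split.
  + by apply: contraTneq s12 => ->; apply: no_chord => /=; lia.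
  + by apply: contraTneq a1 => ->; apply: nc => /=; lia.
  + by apply: contraTneq a2 => ->; apply: nc => /=; lia.
Qed.

End Counting.

(** * Rerouting a path *)


Section Walks.
Variable G : sgraph.
Implicit Types (x y z w : G) (s : seq G).

(** The sequence lists both ends, so the empty one is never a walk and a single vertex is a walk
    from itself to itself. *)
Definition walk x y s :=
  if s is z :: t then [&& z == x, path (@adj G) z t & last z t == y] else false.

Definition upath x y s := walk x y s && uniq s.

Lemma walk_cat x y z w s1 s2 :
  walk x y s1 -> walk z w s2 -> adj y z -> walk x w (s1 ++ s2).
Proof.
case: s1 s2 => [|u s1] [|v s2] //= /and3P[-> p1 /eqP l1] /and3P[/eqP-> p2 l2] yz.
by rewrite cat_path last_cat /= l1 yz p1 p2.
Qed.

Lemma walk_rev x y s : walk x y s -> walk y x (rev s).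
Proof.
case: s => [|u s] //= /and3P[/eqP <- p /eqP <-].
have -> : rev (u :: s) = last u s :: rev (belast u s) by rewrite lastI rev_rcons.
rewrite /walk eqxx /= (@eq_path _ _ (fun z => (@adj G)^~ z)) => [|v w]; last exact: adj_sym.
rewrite rev_path p /=.
by case: s {p} => [|v s] //=; rewrite rev_cons last_rcons.
Qed.

(** Positions [i] to [j], both included. *)
Definition seg s i j := take (j - i).+1 (drop i s).

Lemma size_seg s i j : i <= j < size s -> size (seg s i j) = (j - i).+1.
Proof. by move=> h; rewrite size_takel ?size_drop; lia. Qed.

Lemma mem_seg x0 s i j p : i <= p <= j -> p < size s -> nth x0 s p \in seg s i j.
Proof.
move=> h ps; have -> : nth x0 s p = nth x0 (seg s i j) (p - i).
  by rewrite nth_take ?nth_drop ?subnKC //; lia.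
have lt : p - i < size (seg s i j) by rewrite size_take_min size_drop; lia.
exact: mem_nth.
Qed.

Lemma seg_nth x0 s i j x : i <= j -> x \in seg s i j ->
  exists2 p, i <= p <= j & x = nth x0 s p.
Proof.
move=> ij /(nthP x0)[p]; rewrite size_take_min leq_min => /andP[pj].
rewrite size_drop => ps <-; exists (i + p); first by lia.
by rewrite nth_take ?nth_drop.
Qed.

Lemma walk_seg x0 s i j : sorted (@adj G) s -> i <= j < size s ->
  walk (nth x0 s i) (nth x0 s j) (seg s i j).
Proof.
move=> ss h; have ss' : sorted (@adj G) (seg s i j) by rewrite take_sorted ?drop_sorted.
have hs := size_seg h; rewrite /walk.
have e0 : nth x0 (seg s i j) 0 = nth x0 s i by rewrite nth_take ?nth_drop ?addn0.
have e1 : nth x0 (seg s i j) (j - i) = nth x0 s j.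
  by rewrite nth_take ?nth_drop ?subnKC //; lia.
case: (seg s i j) hs e0 e1 ss' => [|u t] //= [hs] -> e1 pt; rewrite eqxx pt /= -e1.
by case: (j - i) hs {e1} => [/size0nil ->|n] //= st; rewrite (last_nth x0) st.
Qed.

Lemma walk_sorted x y s : walk x y s -> sorted (@adj G) s.
Proof. by case: s => //= u t /and3P[]. Qed.

Lemma walk_head x y s x0 : walk x y s -> nth x0 s 0 = x.
Proof. by case: s => //= u t /and3P[/eqP]. Qed.

Lemma walk_last x y s x0 : walk x y s -> nth x0 s (size s).-1 = y.
Proof. by case: s => //= u t /and3P[_ _ /eqP <-]; rewrite (last_nth x0). Qed.

Lemma walk_size x y s : walk x y s -> 0 < size s.
Proof. by case: s. Qed.

End Walks.

(** * Paths that cannot be shortened while keeping [X] *)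

Section Relink.
Variables (G : sgraph) (a b : G) (T : seq G) (X : {set G}).
Hypotheses (Tp : upath a b T).
Hypothesis irr : forall Q, upath a b Q -> {subset Q <= T} ->
  {in X, forall x, x \in T -> x \in Q} -> size T <= size Q.

Local Notation t := (nth a T).
Local Notation m := (size T).

(** A stretch whose interior a rerouting may drop: losing it shortens the path and costs no vertex
    of [X]. *)
Definition gap p p' := [/\ p.+1 < p', p' < m & forall q, p < q < p' -> t q \notin X].

(** What survives of [T] from position [i] on when the interiors of the listed gaps are dropped. *)
Fixpoint core i (ps : seq (nat * nat)) :=
  if ps is (p, p') :: ps then seg T i p ++ core p' ps else seg T i m.-1.

Fixpoint valid i (ps : seq (nat * nat)) : Prop :=
  if ps is (p, p') :: ps then [/\ i <= p, gap p p' & valid p' ps] else True.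

Lemma core_subseq i ps : i < m -> valid i ps -> subseq (core i ps) (drop i T).
Proof.
elim: ps i => [|[p p'] ps IH] i im /=; first by rewrite take_subseq.
case=> ip [pp' p'm _] /(IH _ p'm) sub.
rewrite -[X in subseq _ X](cat_take_drop (p - i).+1 (drop i T)) cat_subseq // drop_drop.
have -> : (p - i).+1 + i = p.+1 by lia.
apply: subseq_trans sub _.
have -> : p' = (p' - p.+1) + p.+1 by lia.
by rewrite -drop_drop drop_subseq.
Qed.

Lemma core_X i ps q : i < m -> valid i ps -> i <= q < m -> t q \in X ->
  t q \in core i ps.
Proof.
elim: ps i => [|[p p'] ps IH] i im /=.
  by move=> _ h _; apply: mem_seg; lia.
case=> ip [pp' p'm gX] v h qX; rewrite mem_cat.
have [qp|pq] := leqP q p; first by rewrite mem_seg //; lia.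
have [le|lt] := leqP p' q; first by rewrite IH ?orbT //; lia.
by have := gX q; rewrite pq lt qX => /(_ isT).
Qed.

Lemma size_core i ps : i < m -> valid i ps -> size (core i ps) + size ps <= m - i.
Proof.
elim: ps i => [|[p p'] ps IH] i im /=.
  by move=> _; rewrite size_seg; lia.
case=> ip [pp' p'm gX] v; rewrite size_cat size_seg; last by lia.
have := IH _ p'm v; lia.
Qed.

(** A rearrangement of the surviving segments is repetition-free, stays in [T], keeps [X] and is
    shorter than [T]. Hence only the walk property has to be checked to contradict [irr]. *)
Lemma relink ps Q : valid 0 ps -> 0 < size ps -> perm_eq Q (core 0 ps) ->
  walk a b Q -> False.
Proof.
move=> v ps0 pQ wQ; have [wT uT] := andP Tp; have m0 := walk_size wT.
have sub := core_subseq m0 v; rewrite drop0 in sub.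
have := size_core m0 v; rewrite -(perm_size pQ).
have : m <= size Q.
  apply: irr.
  - by rewrite /upath wQ (perm_uniq pQ) (subseq_uniq sub).
  - by move=> x; rewrite (perm_mem pQ); apply: mem_subseq.
  - move=> x xX /(nthP a)[q qm E]; rewrite (perm_mem pQ) -E core_X //.
    by rewrite E.
lia.
Qed.

Let sT : sorted (@adj G) T.
Proof. by have [/walk_sorted] := andP Tp. Qed.

Let walk_first p : p < m -> walk a (t p) (seg T 0 p).
Proof.
move=> pm; have [wT _] := andP Tp; rewrite -{1}(walk_head a wT).
exact: walk_seg.
Qed.

Let walk_final p : p < m -> walk (t p) b (seg T p m.-1).
Proof.
move=> pm; have [wT _] := andP Tp; rewrite -(walk_last a wT).
by apply: walk_seg => //; lia.
Qed.

Lemma no_skip p p' : gap p p' -> ~~ adj (t p) (t p').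
Proof.
move=> g; apply/negP => e; have [g1 g2 _] := g.
apply: (@relink [:: (p, p')] (core 0 [:: (p, p')])) => //=.
by apply: walk_cat e; [apply: walk_first | apply: walk_final]; lia.
Qed.

(** Go to [p], jump to [q], run backwards to [p'], jump to [q'] and continue to the end. *)
Lemma no_parallel_skip p p' q q' : gap p p' -> gap q q' -> p' <= q ->
  adj (t p) (t q) -> ~~ adj (t p') (t q').
Proof.
move=> g h pq e; apply/negP => e'; have [g1 g2 _] := g; have [h1 h2 _] := h.
apply: (@relink [:: (p, p'); (q, q')]
  (seg T 0 p ++ rev (seg T p' q) ++ seg T q' m.-1)) => //=.
  by apply/permP => P; rewrite !count_cat !count_rev.
apply: walk_cat e; first by apply: walk_first; lia.
apply: walk_cat e'; last by apply: walk_final.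
by apply: walk_rev; apply: walk_seg => //; lia.
Qed.

Section FourGaps.
Variables (p1 p1' p2 p2' p3 p3' p4 p4' : nat).
Hypotheses (g1 : gap p1 p1') (g2 : gap p2 p2') (g3 : gap p3 p3') (g4 : gap p4 p4')
  (le12 : p1' <= p2) (le23 : p2' <= p3) (le34 : p3' <= p4).

Let ps := [:: (p1, p1'); (p2, p2'); (p3, p3'); (p4, p4')].
Let S0 := seg T 0 p1.
Let S1 := seg T p1' p2.
Let S2 := seg T p2' p3.
Let S3 := seg T p3' p4.
Let S4 := seg T p4' m.-1.

Let relink4 Q : perm_eq Q (S0 ++ S1 ++ S2 ++ S3 ++ S4) -> walk a b Q -> False.
Proof. exact: (@relink ps). Qed.

Let w0 : walk a (t p1) S0.
Proof. by apply: walk_first; case: g1; lia. Qed.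
Let w1 : walk (t p1') (t p2) S1.
Proof. by apply: walk_seg => //; case: g2; lia. Qed.
Let w2 : walk (t p2') (t p3) S2.
Proof. by apply: walk_seg => //; case: g3; lia. Qed.
Let w3 : walk (t p3') (t p4) S3.
Proof. by apply: walk_seg => //; case: g4; lia. Qed.
Let w4 : walk (t p4') b S4.
Proof. by apply: walk_final; case: g4. Qed.

(** In this and the next three lemmas one perfect matching joins the left ends of the gaps and a
    different one joins the right ends. For each of these pairs a single walk runs through all five
    segments; its order is the witness given to [relink4]. *)
Lemma no_four_a : adj (t p1) (t p3) -> adj (t p2) (t p4) ->
  adj (t p1') (t p2') -> adj (t p3') (t p4') -> False.
Proof.
move=> e1 e2 e3 e4; rewrite adj_sym in e3.
apply: (@relink4 (S0 ++ rev S2 ++ S1 ++ rev S3 ++ S4)).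
  by apply/permP => P; rewrite !count_cat !count_rev; congr (_ + _); rewrite addnCA.
apply: walk_cat e1 => //; apply: walk_cat e3; first exact: walk_rev.
apply: walk_cat e2 => //; apply: walk_cat e4 => //; exact: walk_rev.
Qed.

Lemma no_four_b : adj (t p1) (t p3) -> adj (t p2) (t p4) ->
  adj (t p1') (t p4') -> adj (t p2') (t p3') -> False.
Proof.
move=> e1 e2 e3 e4; rewrite adj_sym in e2.
apply: (@relink4 (S0 ++ rev S2 ++ S3 ++ rev S1 ++ S4)).
  apply/permP => P; rewrite !count_cat !count_rev; congr (_ + _).
  by rewrite [count P S3 + (count P S1 + _)]addnCA addnCA.
apply: walk_cat e1 => //; apply: walk_cat e4; first exact: walk_rev.
apply: walk_cat e2 => //; apply: walk_cat e3 => //; exact: walk_rev.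
Qed.

Lemma no_four_c : adj (t p1) (t p2) -> adj (t p3) (t p4) ->
  adj (t p1') (t p3') -> adj (t p2') (t p4') -> False.
Proof.
move=> e1 e2 e3 e4; rewrite adj_sym in e2.
apply: (@relink4 (S0 ++ rev S1 ++ S3 ++ rev S2 ++ S4)).
  apply/permP => P; rewrite !count_cat !count_rev; congr (_ + _).
  by rewrite [count P S3 + (count P S2 + _)]addnCA.
apply: walk_cat e1 => //; apply: walk_cat e3; first exact: walk_rev.
apply: walk_cat e2 => //; apply: walk_cat e4 => //; exact: walk_rev.
Qed.

Lemma no_four_d : adj (t p1) (t p4) -> adj (t p2) (t p3) ->
  adj (t p1') (t p3') -> adj (t p2') (t p4') -> False.
Proof.
move=> e1 e2 e3 e4; rewrite adj_sym in e3.
apply: (@relink4 (S0 ++ rev S3 ++ S1 ++ rev S2 ++ S4)).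
  apply/permP => P; rewrite !count_cat !count_rev; congr (_ + _).
  by rewrite addnCA [count P S3 + (count P S2 + _)]addnCA.
apply: walk_cat e1 => //; apply: walk_cat e3; first exact: walk_rev.
apply: walk_cat e2 => //; apply: walk_cat e4 => //; exact: walk_rev.
Qed.

End FourGaps.

Definition apart (p q : nat * nat) := (p.2 <= q.1) || (q.2 <= p.1).

Section FourBlocks.
Variables (x x' y y' z z' w w' : nat).
Hypothesis ap : pairwise apart [:: (x, x'); (y, y'); (z, z'); (w, w')].

(* Only two of the four cross edges are used; which ones depends on the cyclic
   order of the four intervals. *)
Lemma no_four_up z1 z2 w1 w2 : x' <= y -> z' <= w ->
  z <= z1 -> z <= z2 -> w <= w1 -> w <= w2 ->
  gap x x' -> gap y y' -> gap z1 z' -> gap z2 z' -> gap w1 w' -> gap w2 w' ->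
  adj (t x) (t z1) -> adj (t x) (t w1) -> adj (t y) (t z2) -> adj (t y) (t w2) ->
  adj (t x') (t y') -> adj (t z') (t w') -> False.
Proof.
move=> xy zw lz1 lz2 lw1 lw2 gx gy gz1 gz2 gw1 gw2 xz xw yz yw exy ezw.
move: ap; rewrite /= /apart /= !andbT => /and3P[/and3P[_ axz axw] /andP[ayz ayw] _].
have [yz'|zy] := leqP y' z.
  by apply: (no_four_a gx gy gz1 gw2) => //; clear -lz1 lw2 xy yz' zw; lia.
have {ayz} zy' : z' <= y by clear -ayz zy; lia.
have [xz'|zx] := leqP x' z.
  have [yw'|wy] := leqP y' w.
    by apply: (no_four_c gx gz1 gy gw2) => //; clear -lz1 lw2 xz' zy' yw'; lia.
  have {ayw} wy' : w' <= y by clear -ayw wy; lia.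
  apply: (no_four_b gx gz2 gw1 gy) => //; try by rewrite adj_sym.
  - by clear -lz2 xz'; lia.
  - by clear -lw1 zw; lia.
have {axz} zx' : z' <= x by clear -axz zx; lia.
have [yw'|wy] := leqP y' w.
  apply: (no_four_b gz2 gx gy gw1) => //; try by rewrite adj_sym.
  by clear -lw1 yw'; lia.
have {ayw} wy' : w' <= y by clear -ayw wy; lia.
have [xw'|wx] := leqP x' w.
  apply: (no_four_c gz1 gx gw2 gy) => //; try by rewrite adj_sym.
  by clear -lw2 xw'; lia.
have {axw} wx' : w' <= x by clear -axw wx; lia.
apply: (no_four_a gz1 gw2 gx gy) => //; try by rewrite adj_sym.
by clear -lw2 zw; lia.
Qed.

(** Mirror image of [no_four_up]: the cross edges now join right ends, and the two remaining edges
    join left ends. *)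
Lemma no_four_down z1 z2 w1 w2 : x' <= y -> z' <= w ->
  z1 <= z' -> z2 <= z' -> w1 <= w' -> w2 <= w' ->
  gap x x' -> gap y y' -> gap z z1 -> gap z z2 -> gap w w1 -> gap w w2 ->
  adj (t x') (t z1) -> adj (t x') (t w1) -> adj (t y') (t z2) -> adj (t y') (t w2) ->
  adj (t x) (t y) -> adj (t z) (t w) -> False.
Proof.
move=> xy zw lz1 lz2 lw1 lw2 gx gy gz1 gz2 gw1 gw2 xz xw yz yw exy ezw.
move: ap; rewrite /= /apart /= !andbT => /and3P[/and3P[_ axz axw] /andP[ayz ayw] _].
have [yz'|zy] := leqP y' z.
  by apply: (no_four_c gx gy gz1 gw2) => //; clear -lz1 lw2 xy yz' zw; lia.
have {ayz} zy' : z' <= y by clear -ayz zy; lia.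
have [xz'|zx] := leqP x' z.
  have [yw'|wy] := leqP y' w.
    by apply: (no_four_a gx gz1 gy gw2) => //; clear -lz1 lw2 xz' zy' yw'; lia.
  have {ayw} wy' : w' <= y by clear -ayw wy; lia.
  apply: (no_four_d gx gz2 gw1 gy) => //; try by rewrite adj_sym.
  - by clear -lz2 zw; lia.
  - by clear -lw1 wy'; lia.
have {axz} zx' : z' <= x by clear -axz zx; lia.
have [yw'|wy] := leqP y' w.
  apply: (no_four_d gz2 gx gy gw1) => //; try by rewrite adj_sym.
  by clear -lz2 zx'; lia.
have {ayw} wy' : w' <= y by clear -ayw wy; lia.
have [xw'|wx] := leqP x' w.
  apply: (no_four_a gz1 gx gw2 gy) => //; try by rewrite adj_sym.
  - by clear -lz1 zx'; lia.
  - by clear -lw2 wy'; lia.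
have {axw} wx' : w' <= x by clear -axw wx; lia.
apply: (no_four_c gz1 gw2 gx gy) => //; try by rewrite adj_sym.
- by clear -lz1 zw; lia.
- by clear -lw2 wx'; lia.
Qed.
End FourBlocks.

End Relink.

(** * Shortening a path by one vertex *)


Section Absorption.
Variable G : sgraph.
Implicit Types (x y z w : G) (s : seq G).

Lemma seg_all s : 0 < size s -> seg s 0 (size s).-1 = s.
Proof. by move=> s0; rewrite /seg subn0 prednK // drop0 take_size. Qed.

Lemma seg_cat s i j k : i <= j -> j < k -> seg s i k = seg s i j ++ seg s j.+1 k.
Proof.
move=> ij jk; rewrite /seg.
have -> : (k - i).+1 = (j - i).+1 + (k - j.+1).+1 by lia.
rewrite takeD drop_drop; congr (_ ++ take _ (drop _ _)); lia.
Qed.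

(** Go to position [i], step to [w], then to position [j], run backwards to [i.+1] and leave through
    the edge to [j.+1]. *)
Lemma absorb_between a b s w i j : upath a b s -> w \notin s ->
  i < j -> j.+1 < size s -> adj w (nth a s i) -> adj w (nth a s j) ->
  adj (nth a s i.+1) (nth a s j.+1) ->
  exists2 s', upath a b s' & perm_eq s' (w :: s).
Proof.
move=> /andP[ws us] wns ij js wi wj e; have srt := walk_sorted ws.
pose s' := seg s 0 i ++ ([:: w] ++ (rev (seg s i.+1 j) ++ seg s j.+1 (size s).-1)).
have pe : perm_eq s' (w :: s).
  rewrite -[in X in perm_eq _ X](seg_all (walk_size ws)).
  rewrite (@seg_cat s 0 i) //; last by clear -ij js; lia.
  rewrite (@seg_cat s i.+1 j) //; last by clear -ij js; lia.
  by rewrite /s' perm_catCA /= perm_cons perm_cat2l perm_cat2r perm_rev.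
exists s' => //; rewrite /upath (perm_uniq pe) cons_uniq wns us !andbT.
have wf : walk a (nth a s i) (seg s 0 i).
  by rewrite -{1}(walk_head a ws); apply: walk_seg => //; clear -ij js; lia.
have wl : walk (nth a s j.+1) b (seg s j.+1 (size s).-1).
  by rewrite -(walk_last a ws); apply: walk_seg => //; clear -ij js; lia.
have wm : walk (nth a s i.+1) (nth a s j) (seg s i.+1 j).
  by apply: walk_seg => //; clear -ij js; lia.
have w1 : walk w w [:: w] by rewrite /walk /= eqxx.
apply: (walk_cat wf); last by rewrite adj_sym; exact: wi.
by apply: (walk_cat w1 _ wj); apply: walk_cat (walk_rev wm) wl e.
Qed.

(** Apart from the end [b], at least [k + 1] neighbours of [w] on the path have a successor there.
    Two of these successors are adjacent, which is the situation of [absorb_between]. *)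
Lemma absorb k a b s w : alpha_le G k -> upath a b s -> w \notin s ->
  k.+2 <= #|[set x | adj w x && (x \in s)]| ->
  exists2 s', upath a b s' & perm_eq s' (w :: s).
Proof.
move=> ak us wns cw; have [ws uniqs] := andP us; have n0 := walk_size ws.
pose S := [set i : 'I_(size s).-1 | adj w (nth a s i)].
have lts (i : 'I_(size s).-1) : i.+1 < size s.
  by have := ltn_ord i; clear -n0; lia.
have cS : k < #|S|.
  rewrite -ltnS; apply: leq_trans cw _.
  apply: (@leq_trans #|b |: [set nth a s i | i : 'I_(size s).-1 in S]|).
    apply: subset_leq_card; apply/subsetP => x; rewrite !inE => /andP[wx /(nthP a)[i ilt E]].
    have [ei|ni] := eqVneq i (size s).-1; first by rewrite -E ei (walk_last a ws) eqxx.
    have il : i < (size s).-1.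
      by rewrite ltn_neqAle ni -ltnS prednK.
    apply/orP; right; apply/imsetP; exists (Ordinal il); first by rewrite inE /= E.
    by rewrite /= E.
  rewrite cardsU1 -add1n leq_add ?leq_b1 //; exact: leq_imset_card.
pose h (i : 'I_(size s).-1) := nth a s i.+1.
have injh : injective h.
  by move=> i j /eqP; rewrite nth_uniq ?lts // => /eqP[] /val_inj.
have [|_ [_ [/imsetP[i iS ->] /imsetP[j jS ->] e]]] := @exists_edge G k (h @: S) ak.
  by rewrite card_imset.
move: iS jS; rewrite !inE => iS jS.
have [lt|lt|/val_inj eq] := ltngtP i j.
- exact: (absorb_between us wns lt).
- by apply: (absorb_between us wns lt) => //; rewrite adj_sym.
- by rewrite eq adj_irrefl in e.
Qed.

(** Insert missing vertices of [T] one at a time until a single one is missing. A missing vertex is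
    outside [X], so it has [k + 2] neighbours on the current path. *)
Lemma refill k a b (T : seq G) (X : {set G}) (Q : seq G) : alpha_le G k ->
  uniq T -> {subset X <= T} ->
  {in T, forall w, w \notin X -> k.+2 <= #|nbrs X w|} ->
  upath a b Q -> {subset Q <= T} -> {subset X <= Q} -> size Q < size T ->
  exists Q', [/\ upath a b Q', {subset Q' <= T} & size Q' = (size T).-1].
Proof.
move=> ak uT XT hX; have [d] := ubnP (size T - size Q).
elim: d Q => // d IH Q ltd pQ QT XQ ltQ.
have [eq|ne] := eqVneq (size Q) (size T).-1; first by exists Q.
have [wQ uQ] := andP pQ.
have [w wT wnQ] : exists2 w, w \in T & w \notin Q.
  have /allPn[w wT wQ'] : ~~ all (mem Q) T; last by exists w.
  apply/negP => /allP sub; by have := uniq_leq_size uT sub; rewrite leqNgt ltQ.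
have wX : w \notin X by apply: contra wnQ => /XQ.
have [|Q' pQ' pe] := absorb ak pQ wnQ.
  apply: leq_trans (hX w wT wX) _; apply: subset_leq_card; apply/subsetP => x.
  by rewrite !inE => /andP[/XQ -> ->].
have sz := perm_size pe; rewrite /= in sz.
apply: (IH Q') => //; rewrite ?sz.
- by clear -ltd ltQ; lia.
- by move=> x; rewrite (perm_mem pe) inE => /predU1P[->|/QT].
- by move=> x /XQ xQ; rewrite (perm_mem pe) inE xQ orbT.
- by clear -ltQ ne; lia.
Qed.

End Absorption.

(** Allows the blocks to be read backwards, which exchanges lower and upper halves. *)
Lemma edges_pullback_bij (G : sgraph) (P : finType) (g : P -> G) (s : P -> P) :
  bijective s -> edges [set: pullback (g \o s)] = edges [set: pullback g].
Proof.
move=> bs.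
have E (f : P -> G) : edges [set: pullback f] =
    \sum_(x : P) \sum_(y : P) adj (f x) (f y).
  rewrite /edges [LHS](eq_bigl xpredT) => [|x]; last by rewrite inE.
  apply: eq_bigr => x _; rewrite -sum1dep_card big_mkcond /=.
  by apply: eq_bigr => y _; rewrite inE /=; case: (adj _ _).
rewrite !E [RHS](reindex s) /=; last exact: onW_bij.
by apply: eq_bigr => x _; rewrite [RHS](reindex s) //; exact: onW_bij.
Qed.

Section ShortenByOne.
Variables (G : sgraph) (k l : nat).
Hypotheses (ak : alpha_le G k) (l_gt0 : 0 < l) (l_le : l <= k) (k_le : k <= l ^ 3).

Section Irreducible.
Variables (a b : G) (T : seq G) (X : {set G}).
Hypotheses (Tp : upath a b T)
  (cX : #|X| <= k.+2 * k) (sT : 66 * k ^ 2 * l <= size T).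
Hypothesis irr : forall Q, upath a b Q -> {subset Q <= T} ->
  {in X, forall x, x \in T -> x \in Q} -> size T <= size Q.

(** Blocks of [2 * (2 * l + 1)] consecutive vertices, of which only the even offsets become
    positions. Two positions of a block thus always have a vertex strictly between them, as [gap]
    demands. *)
Let M := 4 * l + 2.
Let n := size T %/ M.
Local Notation t := (nth a T).
Let good (i : 'I_n) := [forall r : 'I_M, t (i * M + r) \notin X].
Let I : finType := {i : 'I_n | good i}.
Let pos (i : I) p := val i * M + p.*2.
Let f i p := t (pos i p).

Let M0 : 0 < M. Proof. by rewrite /M addn2. Qed.

Let lt_off p : p <= l.*2 -> p.*2 < M.
Proof. by rewrite /M; clear; lia. Qed.

Let uT : uniq T.
Proof. by case/andP: Tp. Qed.

Let lt_block (i : 'I_n) r : r < M -> i * M + r < size T.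
Proof.
move=> rM; have := ltn_ord i; have := leq_divM (size T) M; rewrite -/n.
nia.
Qed.

Let lt_pos i p : p <= l.*2 -> pos i p < size T.
Proof. by move=> h; apply: lt_block; rewrite /M; lia. Qed.

(** Since [4 * l + 2 <= 6 * l], there are at least [11 * k ^ 2] blocks. At most [#|X| <= 3 * k ^ 2]
    of them meet [X], because the blocks are disjoint. *)
Lemma card_good_blocks : 8 * k ^ 2 <= #|I|.
Proof.
have cn : #|[set i | ~~ good i]| + #|I| = n.
  rewrite -[RHS](card_ord n) -(cardsC [set i | ~~ good i]) card_sig; congr (_ + _).
  by apply: eq_card => i; rewrite !inE negbK.
suff : #|[set i | ~~ good i]| <= #|X|.
  have : 11 * k ^ 2 <= n.
    rewrite leq_divRL; last by rewrite /M; lia.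
    by apply: leq_trans sT; rewrite /M; nia.
  have k0 : 0 < k by lia.
  move=> h1 h2; have : k.+2 * k <= 3 * k ^ 2 by nia.
  by move: cn cX h1 h2; clear; lia.
pose g (i : 'I_n) := odflt a [pick x in X | (index x T %/ M == i)].
have gP i : ~~ good i -> g i \in X /\ index (g i) T %/ M = i.
  case/forallPn => r; rewrite negbK => rX; rewrite /g.
  case: pickP => [x /andP[xX /eqP]|none] //.
  have := none (t (i * M + r)); rewrite rX /= index_uniq ?lt_block //.
  by rewrite divnMDl // divn_small ?ltn_ord // addn0 eqxx.
have injg : {in [set i | ~~ good i] &, injective g}.
  move=> i j; rewrite !inE => /gP[_ gi] /gP[_ gj] E.
  by apply: val_inj; rewrite /= -gi -gj E.
rewrite -(card_in_imset injg); apply: subset_leq_card; apply/subsetP => x.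
by case/imsetP => i; rewrite inE => /gP[h _] ->.
Qed.

Lemma block_inj i j p q : p <= l.*2 -> q <= l.*2 -> f i p = f j q -> i = j /\ p = q.
Proof.
move=> pl ql /eqP; rewrite nth_uniq ?lt_pos // => /eqP E.
have E1 : (pos i p) %/ M = val i.
  by rewrite divnMDl // divn_small ?lt_off // addn0.
have E2 : (pos j q) %/ M = val j.
  by rewrite divnMDl // divn_small ?lt_off // addn0.
have ij : val i = val j by apply: val_inj; rewrite /= -E1 E E2.
split; first exact: val_inj.
move: E; rewrite /pos ij; lia.
Qed.

Lemma block_gap i p q : p < q <= l.*2 -> gap a T X (pos i p) (pos i q).
Proof.
case: i => i gi pq; split.
- by rewrite /pos /=; lia.
- by apply: lt_pos; case/andP: pq.
- rewrite /pos /= => r hr; have rM : r - i * M < M by rewrite /M; lia.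
  have /forallP/(_ (Ordinal rM)) := gi; rewrite /= subnKC //; lia.
Qed.

Lemma block_apart i j p p' q q' : i != j -> p' <= l.*2 -> q' <= l.*2 ->
  apart (pos i p, pos i p') (pos j q, pos j q').
Proof.
move=> ij pl ql; rewrite /apart /= /pos.
have le (u v p0 q0 : nat) : u < v -> p0 <= l.*2 -> u * M + p0.*2 <= v * M + q0.*2.
  move=> uv p0l; apply: (@leq_trans (u.+1 * M)).
    by rewrite mulSn addnC leq_add2r ltnW ?lt_off.
  by rewrite (leq_trans _ (leq_addr _ _)) // leq_mul2r uv orbT.
have : val (val i) != val (val j) by rewrite !(inj_eq val_inj).
by rewrite neq_ltn => /orP[] lt; apply/orP; [left|right]; apply: le.
Qed.

Lemma block_no_chord i p q : p <= l.*2 -> q <= l.*2 -> ~~ adj (f i p) (f i q).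
Proof.
move=> pl ql; have [lt|lt|->] := ltngtP p q; last by rewrite adj_irrefl.
  by apply: (no_skip Tp irr); apply: block_gap; rewrite lt.
by rewrite adj_sym; apply: (no_skip Tp irr); apply: block_gap; rewrite lt.
Qed.

Lemma block_no_parallel i j p p' q q' : i != j -> p < p' <= l.*2 -> q < q' <= l.*2 ->
  adj (f i p) (f j q) -> ~~ adj (f i p') (f j q').
Proof.
move=> ij hp hq.
have [_ pl] := andP hp; have [_ ql] := andP hq.
case/orP: (block_apart p q ij pl ql) => /= le.
  by apply: (no_parallel_skip Tp irr) le; apply: block_gap.
rewrite adj_sym [adj (f i p') _]adj_sym.
by apply: (no_parallel_skip Tp irr) le; apply: block_gap.
Qed.

Let pos_ltn (i j : I) p q : (val i < val j)%N -> p <= l.*2 -> pos i p <= pos j q.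
Proof.
move=> uv pl; rewrite /pos; apply: (@leq_trans ((val i).+1 * M)).
  by rewrite mulSn addnC leq_add2r ltnW ?lt_off.
by rewrite (leq_trans _ (leq_addr _ _)) // leq_mul2r uv orbT.
Qed.

Let pos_le i p q : p <= q -> pos i p <= pos i q.
Proof. by rewrite /pos leq_add2l leq_double. Qed.

Let val_ltP (i j : I) : i != j -> (val i < val j)%N \/ (val j < val i)%N.
Proof.
move=> ij; apply/orP; rewrite -neq_ltn; apply: contraNneq ij => E.
by apply/eqP/val_inj/val_inj.
Qed.

Lemma block_no_four_up i1 i2 j m p1 p2 q1 q2 r1 r2 p1' p2' q r :
  uniq [:: i1; i2; j; m] ->
  [/\ p1 < p1' <= l.*2, p2 < p2' <= l.*2, maxn q1 q2 < q <= l.*2 & maxn r1 r2 < r <= l.*2] ->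
  [/\ adj (f i1 p1) (f j q1), adj (f i1 p1) (f m r1),
      adj (f i2 p2) (f j q2) & adj (f i2 p2) (f m r2)] ->
  adj (f i1 p1') (f i2 p2') /\ adj (f j q) (f m r) -> False.
Proof.
wlog i12 : i1 i2 p1 p2 q1 q2 r1 r2 p1' p2' / (val i1 < val i2)%N.
  move=> h un [hp1 hp2 hq hr] [a1 a2 a3 a4] [b1 b2].
  have : i1 != i2 by move: un; rewrite /= !inE !negb_or => /and4P[/and3P[]].
  case/val_ltP => lt; first by apply: (h i1 i2 p1 p2 q1 q2 r1 r2 p1' p2').
  apply: (h i2 i1 p2 p1 q2 q1 r2 r1 p2' p1') => //.
  - by move: un; rewrite /= !inE !negb_or [i2 == i1]eq_sym => /and4P[/and3P[-> -> ->] /andP[-> ->] -> _].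
  - by rewrite maxnC [maxn r2 _]maxnC.
  - by rewrite adj_sym.
wlog jm : j m q1 q2 r1 r2 q r / (val j < val m)%N.
  move=> h un [hp1 hp2 hq hr] [a1 a2 a3 a4] [b1 b2].
  have : j != m by move: un; rewrite /= !inE !negb_or => /and4P[_ _ -> _].
  case/val_ltP => lt; first by apply: (h j m q1 q2 r1 r2 q r).
  apply: (h m j r1 r2 q1 q2 r q) => //; last by rewrite [adj (f m r) _]adj_sym.
  by move: un; rewrite /= !inE !negb_or [m == j]eq_sym => /and4P[/and3P[-> -> ->] /andP[-> ->] -> _].
move=> un [hp1 hp2 hq hr] [a1 a2 a3 a4] [b1 b2].
have [/andP[lp1 up1] /andP[lp2 up2]] := conj hp1 hp2.
have [/andP[lq uq] /andP[lr ur]] := conj hq hr.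
move: lq lr; rewrite !gtn_max => /andP[lq1 lq2] /andP[lr1 lr2].
(* In blocks [j] and [m] the interval must contain both attachment points, so it starts at the
   smaller one. *)
apply: (@no_four_up _ _ _ _ _ Tp irr (pos i1 p1) (pos i1 p1') (pos i2 p2) (pos i2 p2')
  (pos j (minn q1 q2)) (pos j q) (pos m (minn r1 r2)) (pos m r) _
  (pos j q1) (pos j q2) (pos m r1) (pos m r2)) => //;
  try exact: pos_ltn; try (apply: pos_le; rewrite ?geq_minl ?geq_minr //);
  try (by apply: block_gap; apply/andP; split).
move: un; rewrite /= !inE !negb_or !andbT => /and3P[/and3P[h1 h2 h3] /andP[h4 h5] h6].
by rewrite !block_apart.
Qed.

Lemma block_no_four_down i1 i2 j m p1 p2 q1 q2 r1 r2 p1' p2' q r :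
  uniq [:: i1; i2; j; m] ->
  [/\ p1' < p1 <= l.*2, p2' < p2 <= l.*2, q < minn q1 q2 /\ maxn q1 q2 <= l.*2 &
      r < minn r1 r2 /\ maxn r1 r2 <= l.*2] ->
  [/\ adj (f i1 p1) (f j q1), adj (f i1 p1) (f m r1),
      adj (f i2 p2) (f j q2) & adj (f i2 p2) (f m r2)] ->
  adj (f i1 p1') (f i2 p2') /\ adj (f j q) (f m r) -> False.
Proof.
wlog i12 : i1 i2 p1 p2 q1 q2 r1 r2 p1' p2' / (val i1 < val i2)%N.
  move=> h un [hp1 hp2 hq hr] [a1 a2 a3 a4] [b1 b2].
  have : i1 != i2 by move: un; rewrite /= !inE !negb_or => /and4P[/and3P[]].
  case/val_ltP => lt; first by apply: (h i1 i2 p1 p2 q1 q2 r1 r2 p1' p2').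
  apply: (h i2 i1 p2 p1 q2 q1 r2 r1 p2' p1') => //.
  - by move: un; rewrite /= !inE !negb_or [i2 == i1]eq_sym => /and4P[/and3P[-> -> ->] /andP[-> ->] -> _].
  - by rewrite minnC maxnC [minn r2 _]minnC [maxn r2 _]maxnC.
  - by rewrite adj_sym.
wlog jm : j m q1 q2 r1 r2 q r / (val j < val m)%N.
  move=> h un [hp1 hp2 hq hr] [a1 a2 a3 a4] [b1 b2].
  have : j != m by move: un; rewrite /= !inE !negb_or => /and4P[_ _ -> _].
  case/val_ltP => lt; first by apply: (h j m q1 q2 r1 r2 q r).
  apply: (h m j r1 r2 q1 q2 r q) => //; last by rewrite [adj (f m r) _]adj_sym.
  by move: un; rewrite /= !inE !negb_or [m == j]eq_sym => /and4P[/and3P[-> -> ->] /andP[-> ->] -> _].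
move=> un [hp1 hp2 [lq uq] [lr ur]] [a1 a2 a3 a4] [b1 b2].
have [/andP[lp1 up1] /andP[lp2 up2]] := conj hp1 hp2.
move: (lq) (lr) (uq) (ur); rewrite !leq_min !geq_max.
move=> /andP[lq1 lq2] /andP[lr1 lr2] /andP[uq1 uq2] /andP[ur1 ur2].
apply: (@no_four_down _ _ _ _ _ Tp irr (pos i1 p1') (pos i1 p1) (pos i2 p2') (pos i2 p2)
  (pos j q) (pos j (maxn q1 q2)) (pos m r) (pos m (maxn r1 r2)) _
  (pos j q1) (pos j q2) (pos m r1) (pos m r2)) => //;
  try exact: pos_ltn; try (apply: pos_le; rewrite ?leq_maxl ?leq_maxr //);
  try (by apply: block_gap; apply/andP; split).
move: un; rewrite /= !inE !negb_or !andbT => /and3P[/and3P[h1 h2 h3] /andP[h4 h5] h6].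
by rewrite !block_apart.
Qed.

(** The counting wants the lower halves to carry at least as many edges as the upper ones. If they
    do not, it is applied to the reversed blocks and yields the mirrored pattern. *)
Lemma irreducible_absurd : False.
Proof.
have cI := card_good_blocks.
have [le|/ltnW le] := leqP (edges [set: pullback (fun x : I * 'I_l => f x.1 (l.+1 + x.2))])
  (edges [set: pullback (fun x : I * 'I_l => f x.1 x.2)]).
  have [i1 [i2 [j [m [p1 [p2 [q1 [q2 [r1 [r2 [p1' [p2' [q [r [un]]]]]]]]]]]]]]] :=
    four_block_pattern ak l_gt0 l_le k_le cI block_inj block_no_chord block_no_parallel le.
  exact: block_no_four_up.
(* Read every block backwards. *)
pose f' i p := f i (l.*2 - p).
have bs : bijective (fun x : I * 'I_l => (x.1, rev_ord x.2)).
  by exists (fun x => (x.1, rev_ord x.2)) => -[i p] /=; rewrite rev_ordK.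
have lowE : edges [set: pullback (fun x : I * 'I_l => f' x.1 x.2)] =
    edges [set: pullback (fun x : I * 'I_l => f x.1 (l.+1 + x.2))].
  rewrite -(edges_pullback_bij _ bs); congr (edges [set: pullback _]).
  apply: funext => -[i p] /=; rewrite /f'; congr (f i _).
  by have := ltn_ord p; clear; lia.
have highE : edges [set: pullback (fun x : I * 'I_l => f' x.1 (l.+1 + x.2))] =
    edges [set: pullback (fun x : I * 'I_l => f x.1 x.2)].
  rewrite -[in RHS](edges_pullback_bij _ bs); congr (edges [set: pullback _]).
  apply: funext => -[i p] /=; rewrite /f'; congr (f i _).
  by have := ltn_ord p; clear; lia.
have inj' i j p q : p <= l.*2 -> q <= l.*2 -> f' i p = f' j q -> i = j /\ p = q.
  move=> pl ql /block_inj[||-> E]; rewrite ?leq_subr //; split=> //.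
  by move: pl ql E; clear; lia.
have chord' i p q : p <= l.*2 -> q <= l.*2 -> ~~ adj (f' i p) (f' i q).
  by move=> _ _; apply: block_no_chord; rewrite leq_subr.
have par' i j p p' q q' : i != j -> p < p' <= l.*2 -> q < q' <= l.*2 ->
    adj (f' i p) (f' j q) -> ~~ adj (f' i p') (f' j q').
  move=> ij hp hq; apply: contraL; apply: block_no_parallel => //.
    by move: hp; clear; lia.
  by move: hq; clear; lia.
rewrite -lowE -highE in le.
have [i1 [i2 [j [m [p1 [p2 [q1 [q2 [r1 [r2 [p1' [p2' [q [r [un [h1 h2 h3 h4] e e']]]]]]]]]]]]]]] :=
    four_block_pattern ak l_gt0 l_le k_le cI inj' chord' par' le.
apply: (block_no_four_down un _ e e'); split.
- by move: h1; clear; lia.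
- by move: h2; clear; lia.
- by move: h3; clear; lia.
- by move: h4; clear; lia.
Qed.

End Irreducible.

(** If no such path exists, then by [refill] no shorter path through [X] exists either, so [T] is
    irreducible. *)
Lemma shorten_by_one (a b : G) T : upath a b T -> 66 * k ^ 2 * l <= size T ->
  exists Q, [/\ upath a b Q, {subset Q <= T} & size Q = (size T).-1].
Proof.
move=> pT sT; have [wT uT] := andP pT.
have [X [XS cX hX]] := dominating_layers k.+2 [set x in T] ak.
have XT : {subset X <= T} by move=> x /(subsetP XS); rewrite inE.
apply: contrapT => none; apply: (irreducible_absurd pT cX sT) => Q pQ QT XQ.
rewrite leqNgt; apply/negP => lt; apply: none.
apply: (refill ak uT XT _ pQ QT _ lt).
  by move=> w wT' wX; apply: hX; rewrite !inE wX.
by move=> x xX; apply: XQ => //; apply: XT.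
Qed.

End ShortenByOne.

(** * Robustly connected subsets and triangle chains *)


Section PathSurgery.
Variable G : sgraph.
Implicit Types (x y z : G) (s c : seq G) (F S Y U V : {set G}).

Lemma walk_behead x y s : walk x y s -> exists t, s = x :: t.
Proof. by case: s => //= u t /and3P[/eqP-> _ _]; exists t. Qed.

Lemma walk_rcons x y s : walk x y s -> exists t, s = rcons t y.
Proof.
by case: s => //= u t /and3P[_ _ /eqP<-]; exists (belast u t); rewrite -lastI.
Qed.

Lemma upath_join x y z s1 s2 : upath x y s1 -> upath y z s2 ->
  {in s1, forall v, v \in s2 -> v = y} ->
  exists s, [/\ upath x z s, size s = (size s1 + size s2).-1 &
               s =i [predU s1 & s2]].
Proof.
move=> /andP[w1 u1] /andP[w2 u2] h; have [t2 E] := walk_behead w2; subst s2.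
exists (s1 ++ t2); split; last first.
- move=> v; rewrite mem_cat !inE; case: eqVneq => [->|] //=.
  by have [t1 ->] := walk_rcons w1; rewrite mem_rcons inE eqxx.
- by rewrite size_cat /= addnS.
- apply/andP; split.
    case: s1 w1 {u1 h} => // u s1 /and3P[/eqP-> p1 /eqP l1].
    case/and3P: w2 => _ p2 l2; rewrite /walk /= eqxx cat_path last_cat l1 p1 p2.
    exact: l2.
  move: u2; rewrite cons_uniq => /andP[yt2 ut2]; rewrite cat_uniq u1 ut2 andbT /=.
  apply/hasPn => v vt2; apply/negP => vs1.
  by move: yt2; rewrite -(h v vs1) ?vt2 // inE vt2 orbT.
Qed.

(** The two common ends are counted twice, hence [- 2]; the size bound excludes running back and
    forth along one edge. *)
Lemma cycle_join x y s1 s2 : upath x y s1 -> upath y x s2 -> x != y ->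
  {in s1, forall v, v \in s2 -> v = x \/ v = y} -> 4 < size s1 + size s2 ->
  exists2 c : seq G, graph_cycle c & size c = size s1 + size s2 - 2.
Proof.
move=> p1 /andP[w2 u2] xy h sz.
have [t Et] := walk_rcons w2; subst s2.
have [ws us] := andP p1.
case: t w2 u2 h sz => [|v t] w2 u2 h sz.
  by case/and3P: w2 => /eqP E; rewrite E eqxx in xy.
have /eqP Ev : v == y by case/and3P: w2.
subst v; exists (s1 ++ t); last by rewrite !size_cat /= !size_rcons; lia.
rewrite /graph_cycle size_cat; apply/andP; split.
  by move: sz; rewrite /= size_rcons; clear; lia.
rewrite /ucycleb; apply/andP; split.
  case: s1 ws {p1 us h sz} => // u s1 /and3P[/eqP-> q1 /eqP l1].
  case/and3P: w2 => _ q2 _; rewrite /= rcons_cat cat_path q1 l1.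
  exact: q2.
move: u2; rewrite rcons_cons cons_uniq rcons_uniq mem_rcons inE negb_or => /and3P[/andP[_ yt] xt ut].
rewrite cat_uniq us ut andbT /=; apply/hasPn => v vt; apply/negP => vs1.
case: (h v vs1); first by rewrite inE mem_rcons inE vt !orbT.
  by move=> E; rewrite -E vt in xt.
by move=> E; rewrite -E vt in yt.
Qed.

(** Among the [k + 1] even positions [0] to [2 * k] some two are joined by a chord. Shortcutting
    along it removes between [1] and [2 * k - 1] vertices, so repetition cannot jump over the target
    window. *)
Lemma shorten_path k x y s m : alpha_le G k -> upath x y s -> 0 < k ->
  2 * k <= m <= size s ->
  exists s', [/\ upath x y s', {subset s' <= s} & size s' <= m < size s' + 2 * k].
Proof.
move=> ak + k0; have [d] := ubnP (size s); elim: d s => // d IH s ltd ps /andP[km ms].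
have [E|ne] := eqVneq m (size s).
  by exists s; split=> //; rewrite E leqnn /= -[X in X < _]addn0 ltn_add2l muln_gt0.
have lt : m < size s by rewrite ltn_neqAle ne.
have [ws us] := andP ps.
pose h (i : 'I_k.+1) := nth x s i.*2.
have hs (i : 'I_k.+1) : i.*2 < size s.
  by have := ltn_ord i; move: km lt; clear; lia.
have injh : injective h.
  move=> i j /eqP; rewrite nth_uniq ?hs // => /eqP /double_inj; exact: val_inj.
have [|_ [_ [/imsetP[i _ ->] /imsetP[j _ ->] e]]] := @exists_edge G k [set h i | i in 'I_k.+1] ak.
  by rewrite card_imset // card_ord.
wlog ij : i j e / i < j => [hw|].
  have [lt'|lt'|/val_inj E] := ltngtP i j; first exact: (hw i j).
    by apply: (hw j i) => //; rewrite adj_sym.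
  by rewrite E adj_irrefl in e.
have hi := hs i; have hj := hs j; have lj := ltn_ord j.
pose s' := seg s 0 i.*2 ++ seg s j.*2 (size s).-1.
have sub : subseq s' s.
  rewrite -[X in subseq _ X](cat_take_drop (i.*2).+1 s) cat_subseq //.
    by rewrite /seg drop0 subn0.
  have -> : seg s j.*2 (size s).-1 = drop j.*2 s.
    by rewrite /seg take_oversize // size_drop; move: hj; clear; lia.
  have -> : j.*2 = (j.*2 - (i.*2).+1) + (i.*2).+1 by move: ij; clear; lia.
  by rewrite -drop_drop drop_subseq.
have ps' : upath x y s'.
  rewrite /upath (subseq_uniq sub us) andbT; apply: (walk_cat _ _ e).
    rewrite -{1}(walk_head x ws); apply: walk_seg; first exact: walk_sorted ws.
    by rewrite hi.
  rewrite -(walk_last x ws); apply: walk_seg; first exact: walk_sorted ws.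
  by move: hj; clear; lia.
have sz : size s' = size s - (j.*2 - i.*2).-1.
  by rewrite size_cat !size_seg; move: hi hj ij; clear; lia.
have ss' := mem_subseq sub.
have [le|gt] := leqP m (size s').
  have [||s'' [p'' sub'' sz'']] := IH s' _ ps'; first by move: sz ltd ij hj; clear; lia.
    by rewrite km le.
  by exists s''; split=> // z /sub''/ss'.
exists s'; split=> //; move: sz gt lt lj ij hj; clear; lia.
Qed.

Definition within S : rel G := [rel x y | [&& x \in S, y \in S & adj x y]].

Lemma connect_upath S x y : x \in S -> connect (within S) x y ->
  exists2 s, upath x y s & {subset s <= S}.
Proof.
move=> xS /connectP[p pp ->]; case/shortenP: pp => p' pp up _.
exists (x :: p'); last first.
  elim: p' x xS pp {up} => [|v p' IH] u uS /=; first by move=> _ z /[!inE]/eqP->.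
  case/andP => /and3P[_ vS _] /(IH _ vS) sub z.
  by rewrite inE => /predU1P[->|/sub].
rewrite /upath up andbT /walk !eqxx andbT /=.
by apply: sub_path pp => u v /and3P[].
Qed.

(* A subset [F] minimal for [c * alpha F <= #|F| + b]: a cut by [b] vertices
   would leave a smaller one, by superadditivity of [alpha]. *)
Lemma robustly_connected_subset k b S : alpha_le G k -> S != set0 ->
  3 * b * k <= #|S| ->
  exists F, [/\ F \subset S, 2 * b <= #|F| &
    forall Y x y, #|Y| <= b -> x \in F :\: Y -> y \in F :\: Y ->
      connect (within (F :\: Y)) x y].
Proof.
move=> ak S0 cS.
pose P F := [&& F != set0, F \subset S & 3 * b * alpha F <= #|F| + b].
have PS : P S.
  rewrite /P S0 subxx /= (leq_trans _ (leq_addr _ _)) // (leq_trans _ cS) //.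
  by rewrite leq_mul2l alpha_leq ?orbT.
case: (@arg_minnP _ S P (fun F => #|F|) PS) => F /and3P[F0 FS cF] minF.
exists F; split=> //.
  have := alpha_gt0 F0; move: cF; clear; nia.
move=> Y x y cY xFY yFY; apply: contraT => nc.
pose F1 := [set z in F :\: Y | connect (within (F :\: Y)) x z].
pose F2 := (F :\: Y) :\: F1.
have xF1 : x \in F1 by rewrite inE xFY connect0.
have yF2 : y \in F2 by rewrite in_setD yFY andbT inE (negbTE nc) andbF.
have sub1 : F1 \subset F.
  by apply/subsetP => z; rewrite !inE => /andP[/andP[]].
have sub2 : F2 \subset F.
  by apply/subsetP => z; rewrite !inE => /andP[_ /andP[]].
have aF : alpha F1 + alpha F2 <= alpha F.
  apply: alphaU => // u v uF1 vF2.
  have vn : v \notin F1 by case/setDP: vF2.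
  split; first by apply: contraNneq vn => <-.
  apply: contra vn => uv; move: uF1 vF2; rewrite inE => /andP[uF cu] /setDP[vF _].
  rewrite inE vF; apply: connect_trans cu (connect1 _).
  by rewrite /within /= uF vF.
have small (Fi : {set G}) z : Fi \subset F -> z \in F -> z \notin Fi -> Fi != set0 ->
    #|Fi| + b < 3 * b * alpha Fi.
  move=> si zF zn Fi0; rewrite ltnNge; apply/negP => le.
  have := minF Fi; rewrite /P Fi0 (subset_trans si FS) le => /(_ isT).
  rewrite leqNgt => /negP; apply; apply: proper_card.
  by apply/properP; split=> //; exists z.
have s1 := small F1 y sub1; have s2 := small F2 x sub2.
have {}s1 : #|F1| + b < 3 * b * alpha F1.
  apply: s1; first by case/setDP: yFY.
    by case/setDP: yF2.
  by apply/set0Pn; exists x.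
have {}s2 : #|F2| + b < 3 * b * alpha F2.
  apply: s2; first by case/setDP: xFY.
    by rewrite in_setD xF1.
  by apply/set0Pn; exists y.
have c12 : #|F1| + #|F2| = #|F :\: Y|.
  rewrite [#|F2|]cardsD (setIidPr _) ?subnKC ?subset_leq_card //;
  by apply/subsetP => z; rewrite inE => /andP[].
have cFY : #|F| <= #|F :\: Y| + b.
  by rewrite -(cardsID Y F) addnC leq_add2l (leq_trans _ cY) // subset_leq_card ?subsetIr.
(* Adding both sides: [#|F1| + #|F2| + 2 * b < 3 * b * alpha F <= #|F| + b], although [F] has at
   most [b] vertices outside [F1] and [F2]. *)
move: aF s1 s2 c12 cFY cF; clear; nia.
Qed.

(** Deleting all neighbours of [x] would isolate it from the rest of [F]. *)
Lemma robust_degree b F x : 1 < b -> 2 * b <= #|F| ->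
  (forall Y x y, #|Y| <= b -> x \in F :\: Y -> y \in F :\: Y ->
      connect (within (F :\: Y)) x y) ->
  x \in F -> b < #|nbrs F x|.
Proof.
move=> b1 cF conn xF; rewrite ltnNge; apply/negP => le.
have xFY : x \in F :\: nbrs F x by rewrite !inE adj_irrefl andbF.
have [y yF xy] : exists2 y, y \in F :\: nbrs F x & y != x.
  have : 1 < #|F :\: nbrs F x|.
    have h := subset_leq_card (subsetIr F (nbrs F x)).
    by move: (cardsID (nbrs F x) F) h le cF b1; clear; lia.
  rewrite (cardsD1 x) xFY add1n ltnS card_gt0 => /set0Pn[y].
  by rewrite in_setD1 => /andP[yx yF]; exists y.
have /connectP[[|z p] /=] := conn _ _ _ le xFY yF.
  by move=> _ E; rewrite E eqxx in xy.
case/andP => /and3P[_ zF xz] _ _.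
by move: zF; rewrite !inE xz andbT => /andP[/negbTE->].
Qed.

(* A chain of [r] triangles, each of which may be traversed by one or two edges. *)
Lemma triangle_chain k b F U x r : alpha_le G k ->
  {in F, forall x, b < #|nbrs F x|} -> #|U| + 2 * r + k <= b ->
  x \in F -> x \notin U ->
  exists e V, [/\ e \in V, V \subset F :\: U, #|V| <= (2 * r).+1 &
    forall t, r < t <= (2 * r).+1 ->
      exists s, [/\ upath x e s, {subset s <= V} & size s = t]].
Proof.
move=> ak deg + xF xU; elim: r => [|r IH] hb.
  exists x, [set x]; split; rewrite ?inE ?cards1 //.
    by apply/subsetP => y /set1P->; rewrite inE xU.
  move=> t ht; exists [:: x]; split.
  - by rewrite /upath /walk /= !eqxx.
  - by move=> y; rewrite !inE.
  - by move: ht; clear; rewrite /=; lia.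
have [|e [V [eV VF cV hV]]] := IH; first by move: hb; clear; lia.
have eF : e \in F by move: (subsetP VF e eV); rewrite inE => /andP[].
(* More than [k] neighbours of the end [e] avoid [U] and the chain built so far; an edge among them
   completes the next triangle. *)
have [|u [w [uN wN uw]]] := @exists_edge G k (nbrs F e :\: (U :|: V)) ak.
  have h1 := subset_leq_card (subsetIr (nbrs F e) (U :|: V)).
  have [h2 _] := leq_card_setU U V.
  by move: (cardsID (U :|: V) (nbrs F e)) h1 h2 (deg e eF) cV hb; clear; lia.
move: uN wN; rewrite !inE !negb_or => /and3P[/andP[uU uV] uF eu] /and3P[/andP[wU wV] wF ew].
have uw' : u != w by apply: contraTneq uw => ->; rewrite adj_irrefl.
exists w, (w |: (u |: V)); split.
- by rewrite !inE eqxx.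
- apply/subsetP => z; rewrite !inE => /or3P[/eqP->|/eqP->|/(subsetP VF)]; rewrite ?inE.
  + by rewrite wU.
  + by rewrite uU.
  + by [].
- by rewrite !cardsU1; move: cV; clear; case: (_ \notin _) (_ \notin _) => [] []; lia.
move=> t ht; have ww : walk w w [:: w] by rewrite /walk /= eqxx.
(* All sizes but the largest step from [e] directly to [w]; only [2 * r + 3] needs the detour
   through [u]. *)
have [le|gt] := leqP t (2 * r).+2.
  have [|s [ps ss szs]] := hV t.-1; first by move: ht le; clear; lia.
  have [ws us] := andP ps.
  exists (s ++ [:: w]); split.
  - rewrite /upath (walk_cat ws ww ew) cats1 rcons_uniq us andbT.
    by apply: contra wV => /ss.
  - by move=> z; rewrite mem_cat !inE => /orP[/ss->|->]; rewrite ?orbT.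
  - by rewrite cats1 size_rcons szs; move: ht; clear; lia.
have [|s [ps ss szs]] := hV (2 * r).+1; first by clear; lia.
have [ws us] := andP ps.
exists (s ++ [:: u; w]); split.
- have wuw : walk u w [:: u; w] by rewrite /walk /= uw !eqxx.
  rewrite /upath (walk_cat ws wuw eu) cat_uniq us [uniq [:: u; w]]/= inE uw' !andbT.
  by apply/hasPn => z; rewrite !inE => /orP[]/eqP->; apply/negP => /ss; apply/negP.
- by move=> z; rewrite mem_cat !inE => /orP[/ss->|/orP[]->]; rewrite ?orbT.
- by rewrite size_cat /= szs; move: ht gt; clear; lia.
Qed.

End PathSurgery.

(** * Long cycles *)


Section LongCycles.
Variable G : sgraph.
Implicit Types (x y z : G) (s c : seq G) (F S Y U V : {set G}).

Lemma graph_cycle_upath c : graph_cycle c ->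
  exists x y, [/\ upath x y c, adj y x & 2 < size c].
Proof.
case/andP => sz /andP[cyc uc]; case: c sz cyc uc => // x t sz.
rewrite [cycle _ _]/= rcons_path => /andP[p e] u.
by exists x, (last x t); rewrite /upath u /walk !eqxx p.
Qed.

Lemma upath_graph_cycle x y s : upath x y s -> adj y x -> 2 < size s -> graph_cycle s.
Proof.
case: s => // u t /andP[/and3P[/eqP-> p /eqP l] us] yx sz.
by rewrite /graph_cycle sz /ucycleb us andbT /= rcons_path p l.
Qed.

(* The part of a Hamilton cycle running from the last to the first vertex of [F]. *)
Lemma outer_arc c F m : graph_cycle c -> {subset F <= take m c} -> 1 < #|F| ->
  exists x y s, [/\ [/\ x \in F, y \in F & x != y], upath x y s,
    {in F, forall z, z \in s -> z = x \/ z = y} & size c < size s + m].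
Proof.
move=> gc FT cF; have [a [b [pc ba sc]]] := graph_cycle_upath gc; have [wc uc] := andP pc.
have F0 : F != set0 by rewrite -card_gt0 ltnW.
have [v0 v0F] := set0Pn _ F0.
case: (@arg_minnP _ v0 (mem F) (fun z => index z c) v0F) => y yF miny.
case: (@arg_maxnP _ v0 (mem F) (fun z => index z c) v0F) => x xF maxx'.
have maxx z : z \in F -> index z c <= index x c := maxx' z.
have inC z : z \in F -> z \in c by move=> /FT /mem_take.
have ltm z : z \in F -> index z c < m by move=> zF; rewrite -in_take ?FT ?inC.
have xy : x != y.
  apply: contraTneq cF => xy; rewrite -leqNgt -(cards1 x); apply: subset_leq_card.
  apply/subsetP => z zF; rewrite inE; have zc := inC _ zF.
  have := miny _ zF; rewrite -xy => le1; have le2 := maxx _ zF.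
  have /eqP E : index z c == index x c by rewrite eqn_leq le1 le2.
  by rewrite -(nth_index a zc) E nth_index ?inC.
have lt : index y c < index x c.
  rewrite ltn_neqAle miny // andbT; apply: contraNneq xy => E.
  by rewrite -(nth_index a (inC _ xF)) -E nth_index ?inC.
have ltx : index x c < size c by rewrite index_mem inC.
have lty : index y c < size c by rewrite index_mem inC.
have srt := walk_sorted wc.
have w1 : walk x b (seg c (index x c) (size c).-1).
  rewrite -[x in walk x](nth_index a (inC _ xF)) -(walk_last a wc).
  by apply: walk_seg => //; move: ltx; clear; lia.
have w2 : walk a y (seg c 0 (index y c)).
  rewrite -[y in walk _ y](nth_index a (inC _ yF)) -[a in walk a _](walk_head a wc).
  by apply: walk_seg.
exists x, y, (seg c (index x c) (size c).-1 ++ seg c 0 (index y c)); split=> //.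
- rewrite /upath (walk_cat w1 w2 ba) uniq_catC.
  apply: subseq_uniq uc; rewrite -[X in subseq _ X](cat_take_drop (index y c).+1 c).
  rewrite cat_subseq //; first by rewrite /seg drop0 subn0.
  have -> : seg c (index x c) (size c).-1 = drop (index x c) c.
    by rewrite /seg take_oversize // size_drop; move: ltx; clear; lia.
  have -> : index x c = (index x c - (index y c).+1) + (index y c).+1.
    by move: lt; clear; lia.
  by rewrite -drop_drop drop_subseq.
- move=> z zF; rewrite mem_cat => /orP[] h.
    left; have [|p /andP[p1 p2] E] := @seg_nth _ a _ _ _ _ _ h.
      by move: ltx; clear; lia.
    have pc' : p < size c by move: ltx p2; clear; lia.
    have := maxx _ zF; rewrite E index_uniq // => p3.
    have -> : p = index x c by apply/eqP; rewrite eqn_leq p1 p3.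
    by rewrite nth_index ?inC.
  right; have [//|p /andP[p1 p2] E] := @seg_nth _ a _ _ _ _ _ h.
  have pc' : p < size c by move: lty p2; clear; lia.
  have := miny _ zF; rewrite E index_uniq // => p3.
  have -> : p = index y c by apply/eqP; rewrite eqn_leq p2 p3.
  by rewrite nth_index ?inC.
- rewrite size_cat !size_seg //; last by move: ltx; clear; lia.
  by have := ltm _ xF; move: ltx; clear; lia.
Qed.

(** The cycle consists of a triangle chain from [y] to [e] in [F], a path of at most [2 * k]
    vertices from [e] back to [x] in [F], and the shortened arc from [x] to [y] outside [F]. *)
Lemma long_cycles k c l : alpha_le G k -> 0 < k -> graph_cycle c ->
  6 * k <= l -> l + 24 * k ^ 2 <= size c ->
  exists2 s : seq G, graph_cycle s & size s = l.
Proof.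
move=> ak k0 gc l1 l2; have uc : uniq c by case/andP: gc => _ /andP[].
pose S := [set x in take (24 * k ^ 2) c].
have cS : #|S| = 24 * k ^ 2.
  rewrite cardsE; have /card_uniqP -> : uniq (take (24 * k ^ 2) c) by rewrite take_uniq.
  by rewrite size_takel //; move: l2; clear; lia.
have S0 : S != set0 by rewrite -card_gt0 cS muln_gt0 expn_gt0 k0.
(* Here [b = 8 * k], so that [3 * b * k = 24 * k ^ 2]. It exceeds the [5 * k + 1] needed to build
   the chain and the at most [4 * k] chain vertices deleted later. *)
have [|F [FS cF conn]] := @robustly_connected_subset G k (8 * k) S ak S0.
  by rewrite cS; clear; nia.
have deg : {in F, forall x, 8 * k < #|nbrs F x|}.
  by move=> x; apply: (robust_degree _ cF conn); move: k0; clear; lia.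
have [||x [y [s [[xF yF xy] ps sF szs]]]] := @outer_arc c F (24 * k ^ 2) gc.
- by move=> z /(subsetP FS); rewrite inE.
- by move: cF k0; clear; lia.
have [|||e [V [eV VF cV chain]]] := @triangle_chain G k (8 * k) F [set x] y (2 * k) ak deg.
- by rewrite cards1; move: k0; clear; lia.
- by [].
- by rewrite inE eq_sym.
have xV : x \notin V by apply/negP => /(subsetP VF); rewrite !inE eqxx.
have [eF ex] : e \in F /\ e != x.
  by have := subsetP VF e eV; rewrite !inE => /andP[].
pose Y := V :\ e.
have [q pq qF] : exists2 q, upath e x q & {subset q <= F :\: Y}.
  apply: connect_upath; first by rewrite !inE eqxx eF.
  apply: conn; rewrite ?inE ?eqxx ?eF ?xF ?(negbTE xV) ?andbF //.
  by move: cV k0; rewrite (cardsD1 e V) eV /Y; clear; lia.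
have [q' [pq' qF' sq']] : exists q', [/\ upath e x q', {subset q' <= F :\: Y} & size q' <= 2 * k].
  have [le|gt] := leqP (size q) (2 * k); first by exists q.
  have [|q' [pq' sub /andP[le _]]] := @shorten_path G k e x q (2 * k) ak pq k0.
    by rewrite leqnn ltnW.
  by exists q'; split=> // z /sub /qF.
have sq2 : 1 < size q'.
  have [+ _] := andP pq'; case: (q') => [|u [|v w]] //= /andP[/eqP-> /eqP E].
  by rewrite E eqxx in ex.
(* The target leaves [2 * k + 1] vertices for the chain; [s'] misses it by less than [2 * k], which
   the chain can make up. *)
have [|s' [ps' ss' szs']] := @shorten_path G k x y s (l + 2 - size q' - 2 * k) ak ps k0.
  by move: szs sq' l1 l2 k0 sq2; clear; lia.
(* The joins [e], [x] and [y] are counted twice, hence [+ 3]. *)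
have [|p [pp pV szp]] := chain (l + 3 - size q' - size s').
  by move: szs' sq' l1 sq2 k0; clear; lia.
have [|w [pw szw memw]] := @upath_join G y e x p q' pp pq'.
  move=> v /pV vV /qF'; rewrite !inE vV andbT negbK => /andP[/eqP] //.
have [|||c' gc' sc'] := @cycle_join G y x w s' pw ps'.
- by rewrite eq_sym.
- move=> v; rewrite memw inE => hv vs.
  have vF : v \in F.
    by case/orP: hv => [/pV/(subsetP VF)|/qF']; rewrite !inE => /andP[].
  by case: (sF v vF (ss' _ vs)); [right|left].
- by rewrite szw szp; move: szs' sq' l1 sq2 k0; clear; lia.
exists c' => //; rewrite sc' szw szp; move: szs' sq' l1 sq2 k0; clear; lia.
Qed.

End LongCycles.

(** * Short cycles *)


Section ShortCycles.
Variable G : sgraph.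
Implicit Types (x y z u v : G) (S : {set G}).

Lemma leq_alphaS S1 S2 : S1 \subset S2 -> alpha S1 <= alpha S2.
Proof.
by move=> s12; have [A [iA AS <-]] := alphaP S1; apply: leq_alpha (subset_trans AS _).
Qed.

(* Vertices without a smaller neighbour form an independent set; remove them
   and extend a path of the remaining graph downwards. *)
Lemma increasing_path (ord : G -> nat) t S :
  {in S &, injective ord} -> t * alpha S < #|S| ->
  exists s, [/\ sorted (fun u v => adj u v && (ord u < ord v)) s, {subset s <= S} &
    size s = t.+1].
Proof.
elim: t S => [|t IH] S inj lt.
  have /card_gt0P[x xS] : 0 < #|S| by apply: leq_ltn_trans lt.
  by exists [:: x]; split=> // y; rewrite inE => /eqP->.
pose A := [set u in S | [forall v in S, adj v u ==> (ord u <= ord v)]].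
have AS : A \subset S by apply/subsetP => u; rewrite inE => /andP[].
have iA : independent A.
  apply/independentP => u v; rewrite !inE => /andP[uS /forall_inP hu] /andP[vS /forall_inP hv].
  apply/negP => uv; have := hu v vS; have := hv u uS; rewrite uv adj_sym uv /= => le1 le2.
  have E : u = v by apply: inj => //; apply/eqP; rewrite eqn_leq le1 le2.
  by rewrite E adj_irrefl in uv.
have cA : #|A| <= alpha S by apply: leq_alpha.
have sub : S :\: A \subset S by apply: subsetDl.
have [||s [ss sS sz]] := IH (S :\: A).
- by move=> u v /(subsetP sub) uS /(subsetP sub) vS; apply: inj.
- have := leq_alphaS sub; move: (cardsD S A) lt cA; rewrite (setIidPr AS).
  have := subset_leq_card AS; clear; nia.
case: s ss sS sz => // u s ss sS sz.
have : u \in S :\: A by apply: sS; rewrite inE eqxx.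
rewrite !inE => /andP[+ uS]; rewrite uS /= => /forall_inPn[v vS].
rewrite negb_imply -ltnNge => vu; exists (v :: u :: s); split.
- by rewrite /= vu.
- by move=> z; rewrite inE => /predU1P[->|/sS/(subsetP sub)].
- by rewrite /= -[RHS]/(t.+1.+1) -sz.
Qed.

(** * Breadth-first layers and cycles through common ancestors *)

Section Layers.
Variables (S : {set G}) (root : G).

(** Layer and ball of radius [i] around [root] inside [S], built together because a new layer must
    avoid the whole previous ball. *)
Fixpoint layers i : {set G} * {set G} :=
  if i is j.+1 then
    let L := [set y in S :\: (layers j).2 | [exists u in (layers j).1, adj u y]] in
    (L, (layers j).2 :|: L)
  else ([set root], [set root]).

Definition layer i := (layers i).1.
Definition ball i := (layers i).2.

Lemma layerS i : layer i.+1 = [set y in S :\: ball i | [exists u in layer i, adj u y]].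
Proof. by []. Qed.

Lemma ballS i : ball i.+1 = ball i :|: layer i.+1.
Proof. by []. Qed.

Lemma layer_ball i : layer i \subset ball i.
Proof. by case: i => [|i]; [exact: subxx | rewrite ballS subsetUr]. Qed.

Lemma ball_layer i y : y \in ball i -> exists2 j, j <= i & y \in layer j.
Proof.
elim: i => [|i IH]; first by exists 0.
by rewrite ballS => /setUP[/IH[j ji yj]|yi]; [exists j => //; exact: leqW | exists i.+1].
Qed.

Lemma layer_sub i : root \in S -> layer i \subset S.
Proof.
move=> rS; case: i => [|i]; first by rewrite sub1set.
by apply/subsetP => y; rewrite layerS !inE => /andP[/andP[]].
Qed.

Lemma ball_mono i j : i <= j -> ball i \subset ball j.
Proof.
elim: j => [|j IH]; first by rewrite leqn0 => /eqP->.
rewrite leq_eqVlt => /predU1P[->//|/IH sub].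
by rewrite ballS (subset_trans sub) // subsetUl.
Qed.

Lemma layer_notin_ball i j y : y \in layer j -> i < j -> y \notin ball i.
Proof.
case: j => // j; rewrite layerS !inE ltnS => /andP[/andP[yb _] _] /ball_mono sub.
by apply: contra yb; apply: (subsetP sub).
Qed.

Lemma layer_adj i u y : u \in layer i -> adj u y -> y \in S -> y \in ball i.+1.
Proof.
move=> ui uy yS; rewrite ballS layerS !inE yS andbT.
case: (y \in ball i) => //=; apply/exists_inP; by exists u.
Qed.

Lemma layer_adj_near i u y : root \in S -> u \in layer i -> adj u y -> y \in S ->
  exists j, [/\ y \in layer j, j <= i.+1 & i <= j.+1].
Proof.
move=> rS ui uy yS; have [j ji yj] := ball_layer (layer_adj ui uy yS).
exists j; split=> //; rewrite leqNgt; apply/negP => lt.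
have := layer_notin_ball ui lt; rewrite (layer_adj yj) //; first by rewrite adj_sym.
exact: (subsetP (layer_sub i rS)).
Qed.

Definition par i y := odflt root [pick u in layer i | adj u y].

Lemma parP i y : y \in layer i.+1 -> par i y \in layer i /\ adj (par i y) y.
Proof.
rewrite layerS !inE => /andP[_ /exists_inP[u uL uy]]; rewrite /par.
case: pickP => [v /andP[vL vy]|/(_ u)] //=.
by rewrite uL uy.
Qed.

(* The position of a vertex in the plane drawing of the search tree. *)
Fixpoint code i y :=
  if i is j.+1 then code j (par j y) * #|G| + enum_rank y else 0.

(** Ranks are below [#|G|], so division by [#|G|] recovers the code of the parent: tree edges do not
    cross. *)
Lemma code_par i y z : code i.+1 y <= code i.+1 z ->
  code i (par i y) <= code i (par i z).
Proof.
have G0 : 0 < #|G| by apply/card_gt0P; exists y.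
move/(leq_div2r #|G|); rewrite /= !divnMDl //.
by rewrite !divn_small ?ltn_ord // !addn0.
Qed.

Lemma code_inj i : {in layer i &, injective (code i)}.
Proof.
case: i => [|i] y z; first by move=> /set1P-> /set1P->.
move=> _ _ /= /(congr1 (modn^~ #|G|)); rewrite !modnMDl !modn_small ?ltn_ord //.
by move/val_inj/enum_rank_inj.
Qed.

Variable m : nat.

Section Spread.
Variables (i c : nat) (U : nat -> G).
Hypotheses (UL : forall a, a < m.-1 -> U a \in layer i.+1)
  (Uc : forall a b, a <= b < m.-1 -> code i.+1 (U a) <= code i.+1 (U b))
  (U0 : U 0 != U m.-2)
  (Up : forall a b, a < b < m.-1 -> U a != U b -> exists s, [/\ upath (U a) (U b) s,
     {in s, forall z, z \notin ball i} & size s = b - a + 1 + 2 * c])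
  (cm : 2 * (i.+1 + c) < m).

(** By monotonicity all members of [U] share the parent [z]. A path between two distinct members at
    the right distance in [U], together with [z], is the cycle. *)
Lemma close_at_parent : par i (U 0) = par i (U m.-2) ->
  exists2 s : seq G, graph_cycle s & size s = m.
Proof.
move=> E; set z := par i (U 0) in E.
have parE a : a < m.-1 -> par i (U a) = z.
  move=> am; have a0 : 0 < m.-1 by apply: leq_ltn_trans am.
  have am2 : a <= m.-2 by move: am; clear; lia.
  have mm : m.-2 < m.-1 by move: a0; clear; lia.
  apply: (@code_inj i); try by have [] := parP (UL _).
  - by have [] := parP (UL am).
  - by have [] := parP (UL a0).
  apply/eqP; rewrite eqn_leq {1}E; apply/andP; split; apply: code_par; apply: Uc.
    by rewrite am2.
  by rewrite am.
have [s sm Us] : exists2 s, s < m.-2 & U s != U s.+1.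
  apply: contrapT => none; have cst a : a <= m.-2 -> U a = U 0.
    elim: a => [//|a IH am]; rewrite -(IH (ltnW am)); apply/eqP.
    rewrite eq_sym; apply: contrapT => /negP ne; apply: none; by exists a.
  by have := U0; rewrite (cst m.-2) ?eqxx.
(* Positions [d] apart give a path on [m - 1] vertices. The window from [a] to [b] straddles the
   change after [s], so its ends differ; truncated subtraction makes it start at [0] when [s] is
   small. *)
pose d := m - 2 - 2 * c; pose a := s.+1 - d; pose b := a + d.
have [d0 [as_ sb bm]] : 0 < d /\ [/\ a <= s, s < b & b < m.-1].
  by move: sm cm; rewrite /b /a /d; clear => *; split; last split; lia.
have am : a < m.-1 by move: as_ sm; clear; lia.
have neq : U a != U b.
  have lt : code i.+1 (U s) < code i.+1 (U s.+1).
    rewrite ltn_neqAle Uc ?leqnSn ?andbT; last by move: sm; clear; lia.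
    by apply: contra Us => /eqP/code_inj->; rewrite ?eqxx ?UL //; move: sm; clear; lia.
  apply: contraTneq lt => Eab; rewrite -leqNgt; apply: (@leq_trans (code i.+1 (U b))).
    by apply: Uc; rewrite sb.
  by rewrite -Eab Uc // as_; move: sm; clear; lia.
have [p [pp pB szp]] : exists p, [/\ upath (U a) (U b) p,
     {in p, forall z, z \notin ball i} & size p = b - a + 1 + 2 * c].
  by apply: Up neq; rewrite bm andbT (leq_ltn_trans as_).
have [wp up] := andP pp; have [za ea] := parP (UL am); have [zb eb] := parP (UL bm).
rewrite parE // in za ea; rewrite parE // in eb.
have zp : z \notin p by apply/negP => /pB; rewrite (subsetP (layer_ball i)).
exists (z :: p); last by rewrite /= szp /b /d; move: cm; clear; lia.
apply: (@upath_graph_cycle _ z (U b)).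
- have wz : walk z z [:: z] by rewrite /walk /= eqxx.
  by rewrite /upath (walk_cat wz wp ea) cons_uniq zp up.
- by rewrite adj_sym.
- by rewrite /= szp /b /d; move: cm; clear; lia.
Qed.

(** Distinct parents lie in layer [i], hence off the given path, and prolong it at both ends. *)
Lemma climb i' : i = i'.+1 ->
  let V a := par i (U a) in
  [/\ forall a, a < m.-1 -> V a \in layer i,
   forall a b, a <= b < m.-1 -> code i (V a) <= code i (V b) &
   forall a b, a < b < m.-1 -> V a != V b -> exists s, [/\ upath (V a) (V b) s,
     {in s, forall z, z \notin ball i'} & size s = b - a + 1 + 2 * c.+1]].
Proof.
move=> Ei V; split.
- by move=> a am; have [] := parP (UL am).
- by move=> a b h; apply: code_par; apply: Uc.
move=> a b h ne; have [ab bm] := andP h.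
have am : a < m.-1 by apply: ltn_trans bm.
have [|p [pp pB szp]] := Up h; first by apply: contra_neq ne => E; rewrite /V E.
have [wp up] := andP pp; have [za ea] := parP (UL am); have [zb eb] := parP (UL bm).
have out z : z \in layer i -> z \notin p.
  by move=> zi; apply/negP => /pB; rewrite (subsetP (layer_ball i)).
have w1 x : walk x x [:: x] by rewrite /walk /= eqxx.
exists (V a :: rcons p (V b)); split.
- rewrite /upath cons_uniq rcons_uniq mem_rcons inE negb_or ne out // out // up !andbT.
  rewrite -cats1; apply: (walk_cat (w1 _) _ ea); apply: (walk_cat wp (w1 _)).
  by rewrite adj_sym.
- move=> z; rewrite inE mem_rcons inE => /or3P[/eqP->|/eqP->|/pB].
  + by apply: (@layer_notin_ball _ i) => //; rewrite Ei.
  + by apply: (@layer_notin_ball _ i) => //; rewrite Ei.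
  + by apply: contra; apply/subsetP/ball_mono; rewrite Ei.
- by rewrite /= size_rcons szp; clear; lia.
Qed.

End Spread.

(* Two members of [U] whose ancestors first meet at some layer close a cycle
   through that ancestor. Climbing one layer adds one vertex at both ends ([c]
   counts the layers climbed), so the length depends only on the positions of
   the two members. *)
Lemma close_cycle i c (U : nat -> G) :
  (forall a, a < m.-1 -> U a \in layer i.+1) ->
  (forall a b, a <= b < m.-1 -> code i.+1 (U a) <= code i.+1 (U b)) ->
  U 0 != U m.-2 ->
  (forall a b, a < b < m.-1 -> U a != U b -> exists s, [/\ upath (U a) (U b) s,
     {in s, forall z, z \notin ball i} & size s = b - a + 1 + 2 * c]) ->
  2 * (i.+1 + c) < m ->
  exists2 s : seq G, graph_cycle s & size s = m.
Proof.
elim: i c U => [|i IH] c U UL Uc U0 Up cm.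
  have h a : a < m.-1 -> par 0 (U a) = root.
    by move=> /UL/parP[/set1P].
  apply: (close_at_parent UL Uc U0 Up cm); rewrite !h //; move: cm; clear; lia.
have [E|ne] := eqVneq (par i.+1 (U 0)) (par i.+1 (U m.-2)).
  exact: (close_at_parent UL Uc U0 Up cm).
have [VL Vc Vp] := climb UL Uc Up erefl.
by apply: (IH c.+1 _ VL Vc ne Vp); move: cm; clear; lia.
Qed.

(** A larger layer contains a code-increasing path on [m - 1] vertices. Its subpaths are the paths
    that [close_cycle] asks for with [c = 0]. *)
Lemma layer_colouring i : 2 * i.+1 < m -> root \in S ->
  (forall s : seq G, graph_cycle s -> size s <> m) ->
  #|layer i.+1| <= (m - 2) * alpha (layer i.+1).
Proof.
move=> im rS noC; rewrite leqNgt; apply/negP => lt.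
have [s [ss sL sz]] := increasing_path (@code_inj i.+1) lt.
have {}sz : size s = m.-1 by rewrite sz; move: im; clear; lia.
have lts a b : a < b < m.-1 -> code i.+1 (nth root s a) < code i.+1 (nth root s b).
  move=> /andP[ab bm]; have : sorted (relpre (code i.+1) ltn) s.
    by apply: sub_sorted ss => u v /andP[].
  move=> srt; apply: (sorted_ltn_nth (fun y x z => @ltn_trans _ _ _) root srt) => //.
    by rewrite inE sz (ltn_trans ab).
  by rewrite inE sz.
have ssa : sorted (@adj G) s by apply: sub_sorted ss => u v /andP[].
have us : uniq s.
  apply/(uniqP root) => a b; rewrite !inE sz => am bm E.
  by have [lt'|lt'|//] := ltngtP a b; have := @lts _ _ (introT andP (conj lt' _)); rewrite E ltnn => /(_ ltac:(assumption)).
case: (@close_cycle i 0 (fun a => nth root s a)) => //.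
- by move=> a am; apply: sL; rewrite mem_nth ?sz.
- move=> a b /andP[]; rewrite leq_eqVlt => /predU1P[->//|ab] bm.
  by apply/ltnW/lts; rewrite ab.
- by rewrite nth_uniq ?sz //; move: im; clear; lia.
- move=> a b /andP[ab bm] _; exists (seg s a b); split.
  + rewrite /upath walk_seg ?sz ?(ltnW ab) //.
    by rewrite /seg take_uniq ?drop_uniq.
  + move=> z /mem_take/mem_drop/sL zL.
    by apply: (@layer_notin_ball _ i.+1).
  + by rewrite size_seg ?sz ?(ltnW ab) //; move: ab; clear; lia.
- by rewrite addn0.
Qed.

End Layers.

(** Growth by a factor [q] up to layer [r] would violate [layer_colouring]. At the first layer [L i]
    where growth stops, deleting it with its two neighbouring layers removes at most
    [(q + 2) * #|L i|] vertices and lowers [alpha] by at least [alpha (L i)]; then induct. *)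
Lemma card_leq_alpha m q r S : 2 < m -> 0 < q -> 0 < r -> 2 * r < m ->
  (forall s : seq G, graph_cycle s -> size s <> m) ->
  (forall S', (m - 2) * alpha S' < q ^ r) ->
  #|S| <= (q + 2) * (m - 2) * alpha S.
Proof.
move=> m2 q0 r0 rm noC small; have [d] := ubnP #|S|; elim: d S => // d IH S ltd.
have [->|/set0Pn[x xS]] := eqVneq S set0; first by rewrite cards0.
pose L := layer S x.
have ex : exists i, (i < r) && (#|L i.+1| <= q * #|L i|).
  apply: contrapT => none.
  have big j : j <= r -> q ^ j <= #|L j|.
    elim: j => [|j IHj] jr; first by rewrite /L /layer /= cards1.
    rewrite expnS; apply: leq_trans (_ : q * #|L j| <= _).
      by rewrite leq_mul2l IHj ?orbT // ltnW.
    by rewrite leqNgt; apply/negP => lt; apply: none; exists j; rewrite jr ltnW.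
  have := small (L r); rewrite ltnNge => /negP; apply.
  case: (r) r0 rm big => // r' _ rm big; apply: leq_trans (big r'.+1 _) _ => //.
  exact: layer_colouring.
have [i /andP[ir Pi] mini] := ex_minnP ex.
have {}mini j : j < i -> q * #|L j| < #|L j.+1|.
  move=> ji; rewrite ltnNge; apply/negP => le.
  by have := mini j; rewrite le (ltn_trans ji ir) => /(_ isT); rewrite leqNgt ji.
have colour : #|L i| <= (m - 2) * alpha (L i).
  case: (i) ir => [_|j ir].
    have := @alpha_gt0 G (L 0); rewrite {1 3}/L /layer /= cards1 => a0.
    rewrite muln_gt0 a0 ?andbT; first by move: m2; clear; lia.
    by apply/set0Pn; exists x; rewrite inE.
  apply: layer_colouring => //; move: ir rm; clear; lia.
have [prev [sprev hprev]] : exists prev : {set G}, #|prev| <= #|L i| /\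
    forall j y, y \in L j -> j.+1 = i -> y \in prev.
  case: (i) mini => [|j] mini; first by exists set0; rewrite cards0.
  exists (L j); split; last by move=> j' y yj [<-].
  by have := mini j (ltnSn j); move: q0; clear; nia.
pose del := prev :|: (L i :|: L i.+1).
have cdel : #|del| <= (q + 2) * #|L i|.
  have [h1 _] := leq_card_setU prev (L i :|: L i.+1).
  have [h2 _] := leq_card_setU (L i) (L i.+1).
  by move: h1 h2 sprev Pi; rewrite -/del; clear; nia.
have LS : L i \subset S by apply: layer_sub.
have Li0 : L i != set0.
  case: (i) mini => [|j] mini; first by apply/set0Pn; exists x; rewrite inE.
  by rewrite -card_gt0; apply: leq_ltn_trans (mini j (ltnSn j)).
have aS : alpha (L i) + alpha (S :\: del) <= alpha S.
  apply: alphaU => //; first exact: subsetDl.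
  move=> u y ui /setDP[yS]; rewrite /del !in_setU !negb_or => /and3P[yp yi yi1].
  split; first by apply: contraNneq yi => <-.
  apply/negP => uy; have [j [yj j1 j2]] := layer_adj_near xS ui uy yS.
  have [E|ne] := eqVneq j.+1 i; first by rewrite (hprev j y) in yp.
  have : (j == i) || (j == i.+1) by move: j1 j2 ne; clear; lia.
  by case/orP => /eqP E; [case/negP: yi | case/negP: yi1]; rewrite -E.
have cS : #|S| <= #|del| + #|S :\: del|.
  by rewrite -(cardsID del S) leq_add2r subset_leq_card // subsetIr.
have lt' : #|S :\: del| < #|S|.
  apply: proper_card; apply/properP; split; first exact: subsetDl.
  have [u uL] := set0Pn _ Li0; exists u; first exact: (subsetP LS).
  by rewrite in_setD /del !in_setU uL orbT.
have := IH (S :\: del) (leq_trans lt' ltd).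
move: cS cdel colour aS; clear.
move: (alpha S) (alpha (L i)) (alpha (S :\: del)) #|S| #|L i| #|del| #|S :\: del| => aS aL aD s l' dl sd.
move=> h1 h2 h3 h4 h5.
have h6 : (q + 2) * l' <= (q + 2) * ((m - 2) * aL) by rewrite leq_mul2l h3 orbT.
have h7 : (q + 2) * (m - 2) * (aL + aD) <= (q + 2) * (m - 2) * aS by rewrite leq_mul2l h4 orbT.
move: h1 h2 h5 h6 h7; rewrite mulnDr mulnA; lia.
Qed.

Lemma short_cycles k l m : alpha_le G k -> 0 < k -> l <= k <= l ^ 3 ->
  130 * k ^ 2 * l < #|G| -> 2 < m <= 6 * k -> exists2 s : seq G, graph_cycle s & size s = m.
Proof.
move=> ak k0 /andP[lk kl] cG /andP[m2 mk]; apply: contrapT => none.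
have noC (s : seq G) : graph_cycle s -> size s <> m by move=> gs sm; apply: none; exists s.
have l0 : 0 < l by rewrite lt0n; apply: contraTneq kl => ->; rewrite exp0n // -ltnNge.
have aT := @alpha_leq G k [set: G] ak.
have small (q r : nat) : (m - 2) * k < q ^ r -> forall S, (m - 2) * alpha S < q ^ r.
  by move=> h S; apply: leq_ltn_trans h; rewrite leq_mul2l alpha_leq ?orbT.
(* For [m < 13] one layer suffices, with [q = 10 * k + 1]. Otherwise [2 * 6 < m] allows [r = 6], and
   [q = 2 * l] works because [k ^ 2 <= l ^ 6]. *)
have [m13|m13] := ltnP m 13.
  have h1 : (m - 2) * k < (10 * k).+1 ^ 1 by rewrite expn1; move: m13 k0; clear; nia.
  have := card_leq_alpha [set: G] m2 (ltn0Sn _) (ltn0Sn 0) _ noC (small _ _ h1).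
  rewrite cardsT => /(_ m2) le.
  have h2 : #|G| <= ((10 * k).+1 + 2) * 10 * k.
    apply: leq_trans le _; apply: leq_mul => //; rewrite leq_mul2l; move: m13; clear; lia.
  by move: cG h2 k0 l0; clear; nia.
have h1 : (m - 2) * k < (2 * l) ^ 6.
  rewrite expnMn (_ : l ^ 6 = l ^ 3 * l ^ 3); last by rewrite -expnD.
  have : k * k <= l ^ 3 * l ^ 3 by apply: leq_mul.
  by move: mk k0; clear; nia.
have q0 : 0 < 2 * l by rewrite muln_gt0.
have := card_leq_alpha [set: G] m2 q0 (ltn0Sn 5) _ noC (small _ _ h1).
rewrite cardsT => /(_ m13) le.
have h2 : #|G| <= (2 * l + 2) * (6 * k) * k.
  apply: leq_trans le _; apply: leq_mul => //; rewrite leq_mul2l; move: mk; clear; lia.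
by move: cG h2 k0 l0; clear; nia.
Qed.

End ShortCycles.

(** * Pancyclicity *)


Lemma near_hamilton_path (G : sgraph) k l (x y : G) s d :
  alpha_le G k -> 0 < k -> l <= k <= l ^ 3 -> upath x y s ->
  66 * k ^ 2 * l + d <= size s -> exists2 s', upath x y s' & size s' = size s - d.
Proof.
move=> ak k0 /andP[lk kl] ps.
have l0 : 0 < l by rewrite lt0n; apply: contraTneq kl => ->; rewrite exp0n // -ltnNge.
elim: d => [|d IH] sz; first by exists s; rewrite ?subn0.
have [|s' ps' sz'] := IH; first by move: sz; clear; lia.
have [|t [pt _ szt]] := shorten_by_one ak l0 lk kl ps'.
  by rewrite sz'; move: sz; clear; lia.
by exists t => //; rewrite szt sz'; clear; lia.
Qed.

Lemma hamiltonian_pancyclic (G : sgraph) k l : alpha_le G k -> 0 < k -> l <= k <= l ^ 3 ->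
  130 * k ^ 2 * l < #|G| -> hamiltonian G -> pancyclic G.
Proof.
move=> ak k0 hl cG [c [gc allc]] m /andP[m3 mG].
have [x [y [pc yx szc]]] := graph_cycle_upath gc.
have sc : size c = #|G|.
  have /andP[_ uc] := pc; rewrite -(card_uniqP uc); apply: eq_card => z.
  by rewrite allc.
have ex_seq : (exists2 s : seq G, graph_cycle s & size s = m) ->
    exists s : seq G, graph_cycle s /\ size s = m by case=> s ? ?; exists s.
apply: ex_seq; have [le|gt] := leqP m (6 * k).
  by apply: short_cycles ak k0 hl cG _; rewrite m3.
have [le|gt'] := leqP (m + 24 * k ^ 2) #|G|.
  by apply: (long_cycles ak k0 gc) => //; [exact: ltnW | rewrite sc].
have l0 : 0 < l.
  by case/andP: hl => _; rewrite !lt0n; apply: contraTneq => ->; rewrite exp0n // -ltnNge.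
(* Fewer than [24 * k ^ 2] vertices are removed, so at least [66 * k ^ 2 * l] remain throughout. *)
have [|s ps szs] := @near_hamilton_path G k l x y c (#|G| - m) ak k0 hl pc.
  by rewrite sc; move: cG gt' l0; clear; nia.
exists s; last by rewrite szs sc subKn.
by apply: (upath_graph_cycle ps yx); rewrite szs sc subKn.
Qed.

(** Take the least [l] with [k <= l ^ 3]. If [l >= 2], then [l <= 2 * (l - 1)] and
    [(l - 1) ^ 3 < k]. *)
Lemma cube_root_nat k : 0 < k -> exists l, [/\ l <= k, k <= l ^ 3 & l ^ 3 <= 8 * k].
Proof.
move=> k0; have ex : exists l, k <= l ^ 3 by exists k; rewrite -[X in X <= _]expn1 leq_pexp2l.
have [l kl mini] := ex_minnP ex; exists l; split=> //.
  by apply: mini; rewrite -[X in X <= _]expn1 leq_pexp2l.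
case: l kl mini => [|[|l]] kl mini //; first by move: k0; clear; lia.
have : l.+1 ^ 3 < k by rewrite ltnNge; apply/negP => /mini; rewrite ltnn.
have : l.+2 ^ 3 <= (2 * l.+1) ^ 3 by rewrite leq_exp2r //; clear; lia.
by rewrite expnMn; clear; lia.
Qed.

Import Order.TTheory GRing.Theory Num.Theory.
Local Open Scope ring_scope.

(** Cubing both sides leaves [k ^ 6 * l ^ 3 <= 8 * k ^ 7]. *)
Lemma powR_third_lower (R : realType) (k l : nat) : (l ^ 3 <= 8 * k)%N ->
  (k ^ 2 * l)%:R <= 2 * powR k%:R (7 / 3) :> R.
Proof.
move=> lk; set p := powR _ _.
have p0 : 0 <= p by apply: powR_ge0.
have p3 : p ^+ 3 = k%:R ^+ 7.
  rewrite -powR_mulrn // -powRrM divfK ?pnatr_eq0 //.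
  by rewrite -powR_mulrn ?ler0n.
rewrite -(@ler_pXn2r _ 3) ?nnegrE ?ler0n ?mulr_ge0 //.
rewrite exprMn p3 -!natrX -natrM ler_nat expnMn -expnM.
apply: (@leq_trans (k ^ 6 * (8 * k))%N); first by rewrite leq_mul2l lk orbT.
by rewrite mulnCA -expnSr.
Qed.

Theorem theorem1p1 (R : realType) :
  exists c : R, forall k : nat, (0 < k)%N ->
    forall G : sgraph,
      hamiltonian G ->
      c * powR k%:R (7 / 3) <= #|G|%:R ->
      (independence_number G <= k)%N ->
      pancyclic G.
Proof.
(* [262 = 2 * 131]: the 2 pays for rounding up the cube root, and 131 instead of 130 makes the
   inequality strict. *)
exists 262 => k k0 G hG cG /alpha_le_indnum ak.
have [l [lk kl l8]] := cube_root_nat k0.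
apply: (hamiltonian_pancyclic (l := l) ak k0 _ _ hG); first by rewrite lk kl.
have l0 : (0 < l)%N by rewrite lt0n; apply: contraTneq kl => ->; rewrite exp0n // -ltnNge.
have le : (131 * (k ^ 2 * l) <= #|G|)%N.
  rewrite -(ler_nat R) natrM; apply: le_trans cG.
  rewrite (_ : 262 = 131 * 2); last by rewrite -natrM.
  by rewrite -mulrA ler_pM2l ?ltr0n // powR_third_lower.
by apply: leq_trans le; rewrite -mulnA ltn_pmul2r // muln_gt0 expn_gt0 k0.
Qed.
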